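(* (i) Let $\pi:X\to Y$ be a one-block factor map where $X$ is a topologically mixing shift of finite type and $Y$ is a subshift. Let $\mu$ be the unique invariant Gibbs measure for $f\in C(X)$ and let $\mathcal G$ be the subadditive sequence on $Y$ associated to the relative pressure function $P(\sigma_X,\pi,f)$. If $\pi$ is fiber-wise sub-positive mixing, then $\mathcal G$ is almost additive on $Y$. (ii) The almost additivity of $\mathcal G$ does not imply the fiber-wise sub-positive mixing property of the factor map: there exist a topologically mixing shift of finite type $X$, a subshift $Y$, a one-block factor map $\pi:X\to Y$ that is not fiber-wise sub-positive mixing, and $f\in C(X)$ with unique invariant Gibbs measure $\mu$, such that the sequence $\mathcal G$ associated to $P(\sigma_X,\pi,f)$ is almost additive on $Y$ and the image $\pi\mu$ is an invariant Gibbs measure for some $g\in C(Y)$.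
   Context: A subshift is a closed shift-invariant ($\sigma(X)\subseteq X$) subset of $\{1,\dots,k\}^{\mathbb N}$, $(\sigma x)_i=x_{i+1}$; $B_n(X)$ is its set of $n$-blocks and $[x_1\dots x_n]$ denotes a cylinder set. For a $k\times k$ zero-one matrix $A=(a_{ij})$, the shift of finite type $X_A=\{x\in\{1,\dots,k\}^{\mathbb N}:a_{x_nx_{n+1}}=1\ \forall n\}$ is topologically mixing if $A^p>0$ for some $p\in\mathbb N$. A factor map $\pi:X\to Y$ is a continuous surjection with $\pi\circ\sigma_X=\sigma_Y\circ\pi$; it is one-block if it is induced letterwise by a map on symbols (also denoted $\pi$ and applied to words). $\pi\mu(B)=\mu(\pi^{-1}B)$; $S_ng=\sum_{i=0}^{n-1}g\circ\sigma^i$. For a one-block factor map $\pi:X\to Y$ with $X$ a shift of finite type, $\pi$ is fiber-wise sub-positive mixing if there is $k\in\mathbb N$ such that for any $w\in B_k(Y)$ and any $u_1\dots u_k,\ v_1\dots v_k\in B_k(X)$ with $\pi(u_1\dots u_k)=\pi(v_1\dots v_k)=w$ there is $a_1\dots a_k\in B_k(X)$ with $a_1=u_1$, $a_k=v_k$ and $\pi(a_1\dots a_k)=w$. For $y\in Y$, $n\in\mathbb N$, $g_n(y)=\sup_{E_n(y)}\sum_{x\in E_n(y)}e^{(S_nf)(x)}$, the supremum being over sets $E_n(y)$ consisting of exactly one point from each cylinder $[x_1\dots x_n]$ of $X$ with $\pi(x_1\dots x_n)=y_1\dots y_n$. $\mathcal G=\{\log g_n\}_{n\ge1}$ is the (subadditive)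 sequence associated to the relative pressure function $P(\sigma_X,\pi,f)$. It is almost additive if there is $C>0$ with $e^{-C}g_n(y)g_m(\sigma_Y^ny)\le g_{n+m}(y)\le e^Cg_n(y)g_m(\sigma_Y^ny)$ for all $y\in Y$, $n,m\in\mathbb N$. An invariant Borel probability measure $\mu$ is a Gibbs measure for a continuous function $g$ if there are $P\in\mathbb R$, $C>0$ with $\frac1C\le\mu[x_1\dots x_n]/e^{-nP+(S_ng)(x)}\le C$ for all $x$ and $n\in\mathbb N$. *)

(* Defs.v *)
From HB Require Import structures.
From mathcomp Require Import all_boot all_order all_algebra.
From mathcomp Require Import all_classical all_reals all_analysis.

Set Implicit Arguments.
Unset Strict Implicit.
Unset Printing Implicit Defensive.

Import Order.TTheory GRing.Theory Num.Theory.
Import numFieldNormedType.Exports.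

Local Open Scope classical_set_scope.
Local Open Scope ring_scope.

(* The full shift on a nonempty finite alphabet, with the product of the
   discrete topologies and its Borel sigma-algebra. The alphabet has k + 1
   symbols, and symbols and coordinates are numbered from 0. *)
Definition fullshift (k : nat) : Type :=
  prod_topology (fun _ : nat => discrete_topology 'I_k.+1).

HB.instance Definition _ (k : nat) := Topological.on (fullshift k).
HB.instance Definition _ (k : nat) :=
  isPointed.Build (fullshift k) (fun=> ord0).
HB.instance Definition _ (k : nat) :=
  Measurable.copy (fullshift k) (g_sigma_algebraType (@open (fullshift k))).

Section Subshifts.
Variable k : nat.
Implicit Types (X : set (fullshift k)) (x : fullshift k).

Definition shift x : fullshift k := fun i => x i.+1.

Definition subshift X : Prop := closed X /\ shift @` X `<=` X.

Definition block (n : nat) x : n.-tuple 'I_k.+1 := [tuple x i | i < n].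

Definition blocks (n : nat) X : set (n.-tuple 'I_k.+1) := block n @` X.

Definition cylinder X (n : nat) (w : n.-tuple 'I_k.+1) : set (fullshift k) :=
  [set x | X x /\ block n x = w].

Definition zero_one (A : 'M[nat]_k.+1) : Prop :=
  forall i j, A i j = 0%N \/ A i j = 1%N.

Definition SFT (A : 'M[nat]_k.+1) : set (fullshift k) :=
  [set x | forall n, A (x n) (x n.+1) = 1%N].

Definition mixing_SFT X : Prop :=
  exists A : 'M[nat]_k.+1,
    [/\ zero_one A,
        exists p : nat, (0 < p)%N /\ forall i j, (0 < (A ^+ p) i j)%N &
        X = SFT A].

End Subshifts.

Section Gibbs.
Variables (R : realType) (k : nat).
Implicit Types (X : set (fullshift k)) (f : fullshift k -> R).

(* The Birkhoff sum S_n f. *)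
Definition birkhoff f (n : nat) (x : fullshift k) : R :=
  \sum_(i < n) f (iter i (@shift k) x).

(* An invariant Borel probability measure on the closed set X is represented
   by an invariant Borel probability measure on the full shift giving mass 1
   to X. *)
Definition invariant_on X (mu : probability (fullshift k) R) : Prop :=
  mu X = 1%E /\
  forall B, measurable B -> mu (@shift k @^-1` B) = mu B.

Definition gibbs X f (mu : probability (fullshift k) R) : Prop :=
  invariant_on X mu /\
  exists P C : R, 0 < C /\
    forall x (n : nat), X x -> (0 < n)%N ->
      C^-1 <= fine (mu (cylinder X (block n x)))
                / expR (- n%:R * P + birkhoff f n x) <= C.

Definition unique_gibbs X f (mu : probability (fullshift k) R) : Prop :=
  gibbs X f mu /\
  forall nu : probability (fullshift k) R, gibbs X f nu ->
    forall B, measurable B -> nu B = mu B.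

(* Almost additivity of the sequence (log g_n), expressed on the g_n. *)
Definition almost_additive X (g : nat -> fullshift k -> R) : Prop :=
  exists C : R, 0 < C /\
    forall x (n m : nat), X x -> (0 < n)%N -> (0 < m)%N ->
      expR (- C) * g n x * g m (iter n (@shift k) x) <= g (n + m)%N x /\
      g (n + m)%N x <= expR C * g n x * g m (iter n (@shift k) x).

End Gibbs.

Lemma continuous_coord (S T : topologicalType)
    (g : S -> prod_topology (fun _ : nat => T)) :
  (forall i, continuous (fun x => g x i)) -> continuous g.
Proof.
move=> gc x; apply/cvg_sup => i; move: x.
apply/(@continuousP S (initial_topology (@^~ i))) => _ [B oB <-].
rewrite -comp_preimage; apply: open_comp => // x _; exact: gc.
Qed.

Section Factors.
Variables (k l : nat).
Implicit Types (X : set (fullshift k)) (Y : set (fullshift l)).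

Definition factor_map X Y (pi : fullshift k -> fullshift l) : Prop :=
  [/\ {within X, continuous pi},
      pi @` X = Y &
      forall x, X x -> pi (shift x) = shift (pi x)].

(* The map induced letterwise by a map p on symbols. *)
Definition letterwise (p : 'I_k.+1 -> 'I_l.+1) (x : fullshift k) : fullshift l :=
  fun i => p (x i).

Definition one_block_factor (p : 'I_k.+1 -> 'I_l.+1) X Y : Prop :=
  factor_map X Y (letterwise p).

(* The integer k of the definition is q.+1 here, so that it is positive and
   blocks have a first symbol (index ord0) and a last one (index ord_max). *)
Definition fiberwise_sub_positive_mixing (p : 'I_k.+1 -> 'I_l.+1) X Y : Prop :=
  exists q : nat, forall w : q.+1.-tuple 'I_l.+1, blocks Y w ->
    forall u v : q.+1.-tuple 'I_k.+1,
      blocks X u -> blocks X v ->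
      map_tuple p u = w -> map_tuple p v = w ->
      exists a : q.+1.-tuple 'I_k.+1,
        [/\ blocks X a, tnth a ord0 = tnth u ord0,
            tnth a ord_max = tnth v ord_max & map_tuple p a = w].

(* E consists of exactly one point from each (nonempty) cylinder [x_1...x_n]
   of X such that p(x_1...x_n) = y_1...y_n. *)
Definition fiber_selection (p : 'I_k.+1 -> 'I_l.+1) X (n : nat) (y : fullshift l)
    (E : set (fullshift k)) : Prop :=
  (forall x, E x -> X x /\ map_tuple p (block n x) = block n y) /\
  (forall w : n.-tuple 'I_k.+1, blocks X w -> map_tuple p w = block n y ->
     exists! x, E x /\ cylinder X w x).

(* The function g_n whose logarithms form the sequence associated to the
   relative pressure function P(sigma_X, pi, f). The sums are finite sums, as
   a selection E has at most (k + 1) ^ n points. *)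
Definition relative_partition (R : realType) (p : 'I_k.+1 -> 'I_l.+1) X
    (f : fullshift k -> R) (n : nat) (y : fullshift l) : R :=
  sup [set \sum_(x \in E) expR (birkhoff f n x) |
        E in fiber_selection p X n y].

Lemma letterwise_continuous (p : 'I_k.+1 -> 'I_l.+1) :
  continuous (letterwise p).
Proof.
have pc : continuous
    (p : discrete_topology 'I_k.+1 -> discrete_topology 'I_l.+1).
  by apply/continuousP => A _; exact: discrete_open.
apply: (@continuous_coord (fullshift k) (discrete_topology 'I_l.+1)) => i x.
apply: (@continuous_comp (fullshift k) (discrete_topology 'I_k.+1)
  (discrete_topology 'I_l.+1) (fun x => x i) p); last exact: pc.
exact: (@proj_continuous nat (fun=> discrete_topology 'I_k.+1) i x).
Qed.

Lemma measurable_letterwise (p : 'I_k.+1 -> 'I_l.+1) :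
  measurable_fun [set: fullshift k] (letterwise p).
Proof.
apply: (@measurability _ _ _ _ _ _ (@open (fullshift l))) => //.
move=> _ [B oB <-]; rewrite setTI; apply: sub_sigma_algebra.
by apply: open_comp => // x _; exact: letterwise_continuous.
Qed.

HB.instance Definition _ (p : 'I_k.+1 -> 'I_l.+1) :=
  @isMeasurableFun.Build _ _ (fullshift k) (fullshift l) (letterwise p)
    (measurable_letterwise p).

(* The image measure pi mu, (pi mu)(B) = mu (pi^-1 B). *)
Definition image_measure (R : realType) (p : 'I_k.+1 -> 'I_l.+1)
    (mu : probability (fullshift k) R) : probability (fullshift l) R :=
  distribution mu (letterwise p).

End Factors.

(* Main.v *)
Require Import Defs.
From HB Require Import structures.
From mathcomp Require Import all_boot all_order all_algebra.
From mathcomp Require Import all_classical all_reals all_analysis.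
From mathcomp Require Import ring lra.

Set Implicit Arguments.
Unset Strict Implicit.
Unset Printing Implicit Defensive.

Import Order.TTheory GRing.Theory Num.Theory.
Import numFieldNormedType.Exports.

Local Open Scope classical_set_scope.
Local Open Scope ring_scope.

(** Write G_n(y) for the mu-mass of the set of points of X whose first n symbols
    lie over the first n symbols of y.  The Gibbs inequalities compare each term
    of the sums that define g_n(y) with the mass of a cylinder, so that
    g_n(y) = e^(nP) G_n(y) up to a bounded factor ([relative_partition_fiber_mass]).
    As e^(nP) is multiplicative, almost additivity of the sequence log g_n is a
    property of the masses G_n alone ([almost_additive_fiber_mass]).

    Part (i).  A Gibbs measure is quasi-Bernoulli: the mass of a block uv is the
    mass of u times the mass of v, up to a bounded factor
    ([gibbs_quasi_bernoulli]).  Cutting the words over y at position n gives the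
    upper bound.  For the lower bound fix a preimage z of y.  A word u over the
    first n symbols of y and a word v over the next n' symbols need not be
    composable.  Fiber-wise mixing over blocks of length q + 1 allows the last
    q + 1 symbols of u to be changed so that u ends on the path z ([rejoin]), and
    the first q + 1 symbols of v so that v starts on the path z ([depart]); the
    changed words are composable.  A change of q + 1 symbols alters the mass by a
    bounded factor ([mass_change]), and a bounded number of words are changed into
    the same word ([card_agree_off]), so that only constants are lost.

    Part (ii).  Let X be the edge shift of the complete directed graph with
    vertices 0 and 1, and let p send an edge to the sum of its two vertices
    modulo 2.  Points of X are binary sequences, seen through their pairs of
    consecutive terms, and p takes differences.  Every y has exactly two
    preimages, which are complementary to each other: no path can pass from one
    to the other over y, which refutes fiber-wise mixing, whereas two words lie
    over each word of Y.  With f = 0 and mu the fair coin-tossing measure,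
    obtained from Lebesgue measure by binary expansion, G_n(y) = 2^(-n) for all y.
    Hence log g_n is almost additive and the image of mu is a Gibbs measure
    for 0.

    The uniqueness of mu is the ergodicity of coin tossing.  A Gibbs measure for 0
    has a bounded ratio r to mu on the cylinders, and r(s) is the mean of the
    values of r on the two extensions of the word s, on the left (invariance) as
    well as on the right (additivity).  Comparing r(uv) with r(u) and with r(v)
    for independent uniform words u and v of length n shows that the variance of r
    on words of length 2n is at least 3/2 times its variance on words of length n
    ([second_moment_doubling]).  As r is bounded, all variances are 0
    and r = 1 ([bounded_balanced_eq1]). *)

(** * Cylinders and Borel sets *)

Section Cylinders.
Variable k : nat.
Implicit Types (x z : fullshift k) (X : set (fullshift k)).

Lemma eq_block n x z :
  block n x = block n z <-> forall i, (i < n)%N -> x i = z i.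
Proof.
split=> [e i ltin|e]; last by apply: eq_from_tnth => i; rewrite !tnth_mktuple e.
by move/(congr1 (fun w => tnth w (Ordinal ltin))): e; rewrite !tnth_mktuple.
Qed.

Lemma open_coord i (P : set 'I_k.+1) : open [set x : fullshift k | P (x i)].
Proof.
apply: (@open_comp (fullshift k) (discrete_topology 'I_k.+1) (fun x => x i)).
  move=> x _; exact: (@proj_continuous nat (fun=> discrete_topology 'I_k.+1) i x).
exact: discrete_open.
Qed.

(** The cylinders around x form a base of a filter that converges to x in each
    coordinate, hence in the product topology. *)
Lemma open_cylinder (U : set (fullshift k)) x : open U -> U x ->
  exists n, forall z, block n z = block n x -> U z.
Proof.
move=> oU Ux.
pose F := filter_from [set: nat]
  (fun n => [set z : fullshift k | block n z = block n x]).
have FF : Filter F.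
  apply: filter_from_filter; first by exists 0%N.
  move=> i j _ _; exists (maxn i j) => // z /= /eq_block e.
  by split; apply/eq_block => a lta; apply: e; rewrite leq_max lta ?orbT.
have : F --> (x : fullshift k).
  apply/cvg_sup => i A.
  rewrite (@nbhsE (initial_topology
    (fun u : nat -> discrete_topology 'I_k.+1 => u i))) => -[_ [[C oC <-] Cx] sBA].
  exists i.+1 => // z /= /eq_block e; apply: sBA => /=.
  by rewrite e.
move/(_ U (open_nbhs_nbhs (conj oU Ux))) => -[n _ sU].
by exists n => z e; exact: sU.
Qed.

Lemma measurable_coord i (P : set 'I_k.+1) :
  measurable [set x : fullshift k | P (x i)].
Proof. by apply: sub_sigma_algebra; exact: open_coord. Qed.

Lemma measurable_block n (P : set (n.-tuple 'I_k.+1)) :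
  measurable [set x : fullshift k | P (block n x)].
Proof.
have -> : [set x : fullshift k | P (block n x)] =
    \bigcup_(w in P) \bigcap_(i in [set: 'I_n]) [set x | x i = tnth w i].
  apply/seteqP; split => [x Px|x [w Pw e]] /=.
    by exists (block n x) => // i _ /=; rewrite tnth_mktuple.
  suff -> : block n x = w by [].
  by apply: eq_from_tnth => i; rewrite tnth_mktuple; exact: e.
apply: fin_bigcup_measurable => // w _; apply: fin_bigcap_measurable => // i _.
exact: (@measurable_coord i [set tnth w i]).
Qed.

Lemma measurable_cylinder X n (w : n.-tuple 'I_k.+1) :
  measurable X -> measurable (cylinder X w).
Proof. by move=> mX; apply: measurableI => //; exact: (@measurable_block n [set w]). Qed.

Lemma measure_block_sum (R : realType) (m : {measure set (fullshift k) -> \bar R})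
    X n (Q : pred (n.-tuple 'I_k.+1)) : measurable X ->
  m (X `&` [set x | Q (block n x)]) = (\sum_(w | Q w) m (cylinder X w))%E.
Proof.
move=> mX.
have -> : X `&` [set x | Q (block n x)] = \bigcup_(w in [set` Q]) cylinder X w.
  apply/seteqP; split => [x [Xx Qx]|x [w Qw [Xx e]]] /=.
  - by exists (block n x).
  - by split => //; rewrite e.
rewrite measure_fin_bigcup //.
- by rewrite -(bigfs _ (index_enum_uniq _)) // => w _; rewrite mem_index_enum.
- by move=> w1 w2 _ _ [x [[_ <-] [_ <-]]].
- by move=> w _; exact: measurable_cylinder.
Qed.

(** An open set is the union of the cylinders that it contains, and there are
    countably many cylinders.  The empty set is a generator so that the generators
    are closed under intersection. *)
Lemma borel_cylinders :
  (measurable : set (set (fullshift k))) =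
  <<s [set C | C = set0 \/ exists n (w : n.-tuple 'I_k.+1), C = cylinder setT w] >>.
Proof.
apply/seteqP; split; last first.
  apply: smallest_sub; first exact: sigma_algebra_measurable.
  move=> _ [->|[n [w ->]]]; first exact: measurable0.
  exact: measurable_cylinder.
apply: smallest_sub; first exact: smallest_sigma_algebra.
move=> U oU.
have -> : U = \bigcup_n \bigcup_(w in [set w : n.-tuple 'I_k.+1 | cylinder setT w `<=` U])
    cylinder setT w.
  apply/seteqP; split => [x Ux|x [n _ [w sw]]]; last exact: sw.
  have [n sU] := open_cylinder oU Ux.
  by exists n => //; exists (block n x) => // z [_ /sU].
set G := (X in <<s X >>).
have mG n (w : n.-tuple 'I_k.+1) :
    (measurable : set (set (g_sigma_algebraType G))) (cylinder setT w).
  by apply: sub_sigma_algebra; right; exists n, w.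
apply: (@bigcupT_measurable _ (g_sigma_algebraType G)) => n.
by apply: (@fin_bigcup_measurable _ (g_sigma_algebraType G)).
Qed.

(** Two cylinders are nested or disjoint, so that they form a pi-system. *)
Lemma eq_measure_cylinders (R : realType) (m1 m2 : probability (fullshift k) R) :
  (forall n (w : n.-tuple 'I_k.+1), m1 (cylinder setT w) = m2 (cylinder setT w)) ->
  forall B, measurable B -> m1 B = m2 B.
Proof.
move=> e B; rewrite [measurable]borel_cylinders.
apply: (g_sigma_algebra_measure_unique _ _ (fun=> setT)).
- move=> _ [->|[n [w ->]]]; first exact: measurable0.
  exact: measurable_cylinder.
- move=> _; right; exists 0%N, [tuple]; apply/seteqP; split => // x _; split => //.
  exact: tuple0.
- by rewrite bigcup_const //; exists 0%N.
- have sub n m (v : n.-tuple 'I_k.+1) (w : m.-tuple 'I_k.+1) : (n <= m)%N ->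
      cylinder setT v `&` cylinder setT w = set0 \/
      cylinder setT v `&` cylinder setT w = cylinder setT w.
    move=> lenm; case: (pselect (cylinder setT v `&` cylinder setT w = set0)).
      by left.
    move=> /eqP/set0P[x [[_ vx] [_ wx]]]; right; apply/seteqP; split => [z []|z] //.
    move=> [_ wz]; split => //; split => //; rewrite -vx.
    move: wz; rewrite -wx => /eq_block wz.
    by apply/eq_block => i ltin; apply: wz; exact: leq_trans lenm.
  move=> _ _ [->|[n [v ->]]] [->|[m [w ->]]];
    rewrite ?set0I ?setI0; try by left.
  case/orP: (leq_total n m) => le.
    by have [->|->] := sub _ _ v w le; [left|right; exists m, w].
  by rewrite setIC; have [->|->] := sub _ _ w v le; [left|right; exists n, v].
- by move=> _ [->|[n [w ->]]]; [rewrite !measure0|exact: e].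
- by move=> _ /=; rewrite probability_setT ltry.
Qed.

End Cylinders.

(** * The relative partition function of a Gibbs measure *)

Section Partition.
Variables (R : realType) (k l : nat).
Variables (p : 'I_k.+1 -> 'I_l.+1) (X : set (fullshift k)).
Implicit Types (f : fullshift k -> R) (m : probability (fullshift k) R).

Definition mass m n (w : n.-tuple 'I_k.+1) : R := fine (m (cylinder X w)).

(** Words that are not blocks of X have empty cylinders and contribute 0. *)
Definition fiber_mass m n (y : fullshift l) : R :=
  \sum_(w : n.-tuple 'I_k.+1 | map_tuple p w == block n y) mass m w.

Lemma mass_ge0 m n (w : n.-tuple 'I_k.+1) : 0 <= mass m w.
Proof. by rewrite /mass fine_ge0. Qed.

Lemma fiber_mass_blocks m n y : fiber_mass m n y =
  \sum_(w : n.-tuple 'I_k.+1 | (map_tuple p w == block n y) && `[< blocks X w >])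
    mass m w.
Proof.
rewrite /fiber_mass [RHS]big_mkcondr /=; apply: eq_bigr => w _.
case: asboolP => // nXw; rewrite /mass.
suff -> : cylinder X w = set0 by rewrite measure0.
by apply/seteqP; split => // x [Xx xw]; apply: nXw; exists x.
Qed.

(** With a constant D >= 1 the Gibbs inequalities extend to the empty word. *)
Lemma gibbs_mass f m : gibbs X f m -> exists P D : R, 1 <= D /\
  forall n x, X x -> D^-1 * expR (- n%:R * P + birkhoff f n x) <= mass m (block n x)
    /\ mass m (block n x) <= D * expR (- n%:R * P + birkhoff f n x).
Proof.
move=> [[mX _] [P [C [C0 g]]]]; exists P, (Num.max 1 C); split.
  by rewrite le_max lexx.
have D0 : 0 < Num.max 1 C by rewrite lt_max ltr01.
move=> [|n] x Xx.
  rewrite oppr0 mul0r add0r /birkhoff big_ord0 expR0 !mulr1 /mass.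
  have -> : cylinder X (block 0 x) = X.
    apply/seteqP; split => [z []//|z Xz]; split => //.
    by rewrite tuple0 [RHS]tuple0.
  by rewrite mX /= invf_le1 // le_max lexx.
have /andP[lo hi] := g x n.+1 Xx isT.
rewrite ler_pdivlMr ?expR_gt0 // in lo.
rewrite ler_pdivrMr ?expR_gt0 // in hi.
have W0 := expR_ge0 (- n.+1%:R * P + birkhoff f n.+1 x).
split; last by apply: le_trans hi _; rewrite ler_wpM2r // le_max lexx orbT.
by apply: le_trans lo; rewrite ler_wpM2r // lef_pV2 ?posrE // le_max lexx orbT.
Qed.

(** A selection amounts to a choice of a point h w in each cylinder.  Indexing by
    words makes all the selections comparable term by term. *)
Lemma fiber_selection_sum n y E (F : fullshift k -> R) :
  fiber_selection p X n y E ->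
  exists h : n.-tuple 'I_k.+1 -> fullshift k,
    (forall w, blocks X w -> map_tuple p w = block n y -> cylinder X w (h w)) /\
    \sum_(x \in E) F x =
    \sum_(w : n.-tuple 'I_k.+1 | (map_tuple p w == block n y) && `[< blocks X w >])
      F (h w).
Proof.
move=> [EX Eu].
pose h (w : n.-tuple 'I_k.+1) := xget point [set x | E x /\ cylinder X w x].
have hP w : blocks X w -> map_tuple p w = block n y -> E (h w) /\ cylinder X w (h w).
  by move=> Xw pw; have [x [Ex _]] := Eu w Xw pw;
    apply: (@xgetPex _ point [set x | E x /\ cylinder X w x]); exists x.
have hK x : E x -> h (block n x) = x.
  move=> Ex; have [Xx px] := EX x Ex.
  have Xb : blocks X (block n x) by exists x.
  have [z [_ uz]] := Eu _ Xb px.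
  by rewrite -(uz _ (hP _ Xb px)); apply: uz.
exists h; split; first by move=> w Xw pw; exact: (hP w Xw pw).2.
rewrite (bigfs _ (index_enum_uniq _)); last by move=> w _; rewrite mem_index_enum.
rewrite (_ : [set` _] = block n @` E).
  rewrite fsbig_image; first by apply: eq_fsbigr => x /set_mem Ex; rewrite hK.
  by move=> x z /set_mem Ex /set_mem Ez e; rewrite -(hK _ Ex) e hK.
apply/seteqP; split => w /=.
  move=> /andP[/eqP pw /asboolP Xw]; have [Eh [_ e]] := hP w Xw pw.
  by exists (h w).
move=> [x Ex <-]; have [Xx px] := EX x Ex.
by apply/andP; split; [exact/eqP|apply/asboolP; exists x].
Qed.

Lemma fiber_selection_exists n y : exists E, fiber_selection p X n y E.
Proof.
pose h (w : n.-tuple 'I_k.+1) := xget point (cylinder X w).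
have hP w : blocks X w -> cylinder X w (h w).
  by move=> [x Xx xw]; apply: (@xgetPex _ point (cylinder X w)); exists x.
exists [set x | [/\ X x, map_tuple p (block n x) = block n y & x = h (block n x)]].
split => [x []//|w Xw pw]; exists (h w); have [Xh hw] := hP w Xw; split.
  by split => //; split => //; rewrite hw.
by move=> z [[_ _ e1] [_ e2]]; rewrite [RHS]e1 e2.
Qed.

(** By the Gibbs inequalities, the term of a selected point is the mass of its
    cylinder up to a factor that is the same for all points, so that every sum
    of the supremum is comparable to the same fiber mass. *)
Lemma relative_partition_fiber_mass f m : gibbs X f m ->
  exists P D : R, 0 < D /\ forall n y,
    D^-1 * fiber_mass m n y <= expR (- n%:R * P) * relative_partition p X f n y /\
    expR (- n%:R * P) * relative_partition p X f n y <= D * fiber_mass m n y.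
Proof.
move=> gm; have [P [D [D1 g]]] := gibbs_mass gm.
have D0 : 0 < D by apply: lt_le_trans D1.
exists P, D; split => // n y.
have H E : fiber_selection p X n y E ->
    D^-1 * fiber_mass m n y <=
      expR (- n%:R * P) * \sum_(x \in E) expR (birkhoff f n x) /\
    expR (- n%:R * P) * \sum_(x \in E) expR (birkhoff f n x) <=
      D * fiber_mass m n y.
  move=> /(@fiber_selection_sum _ _ _ (fun x => expR (birkhoff f n x)))[h [hP ->]].
  rewrite fiber_mass_blocks !mulr_sumr; split; apply: ler_sum => w /andP[/eqP pw];
    move=> /asboolP Xw; have [Xh hw] := hP w Xw pw; have := g n _ Xh;
    rewrite hw expRD => -[lo hi].
    by rewrite ler_pdivrMl.
  by rewrite -ler_pdivrMl.
have e0 := expR_gt0 (- n%:R * P).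
have [E0 E0P] := fiber_selection_exists n y.
rewrite /relative_partition; set S := [set _ | _ in _].
have ubS : ubound S (D * fiber_mass m n y / expR (- n%:R * P)).
  by move=> _ [E EP <-]; rewrite ler_pdivlMr // mulrC; have [] := H _ EP.
split.
  apply: le_trans (H _ E0P).1 _; rewrite ler_pM2l //.
  by apply: ub_le_sup; [exists (D * fiber_mass m n y / expR (- n%:R * P))|exists E0].
by rewrite mulrC -ler_pdivlMr //; apply: ge_sup => //;
  exists (\sum_(x \in E0) expR (birkhoff f n x)), E0.
Qed.

(** The factors e^(nP) that relate g_n to the fiber mass are multiplicative in n,
    and the bounded factors are absorbed by the constant. *)
Lemma almost_additive_fiber_mass f m (Y : set (fullshift l)) : gibbs X f m ->
  (exists D : R, 0 < D /\ forall y n n', Y y ->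
    fiber_mass m n y * fiber_mass m n' (iter n (@Defs.shift l) y)
      <= D * fiber_mass m (n + n') y /\
    fiber_mass m (n + n') y
      <= D * (fiber_mass m n y * fiber_mass m n' (iter n (@Defs.shift l) y))) ->
  almost_additive Y (relative_partition p X f).
Proof.
move=> /relative_partition_fiber_mass[P [D [D0 g]]] [D' [D'0 H]].
pose K := D ^+ 3 * D' + 1.
have K1 : 1 < K by rewrite ltrDr mulr_gt0 // exprn_gt0.
have K0 : 0 < K by apply: lt_trans K1.
exists (ln K); split; first by rewrite ln_gt0.
move=> y n n' Yy _ _; rewrite expRN lnK ?posrE //.
have [lo hi] := H y n n' Yy.
have [l1 h1] := g n y; have [l2 h2] := g n' (iter n (@Defs.shift l) y).
have [l3 h3] := g (n + n')%N y.
have FP i x : 0 <= fiber_mass m i x by apply: sumr_ge0 => w _; exact: mass_ge0.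
move: (FP n y) (FP n' (iter n (@Defs.shift l) y)) (FP (n + n')%N y).
rewrite natrD opprD mulrDl expRD in l3 h3.
move: l1 h1 l2 h2 l3 h3 lo hi; rewrite !ler_pdivrMl //.
set a := expR _; set b := expR _; set A := relative_partition _ _ _ _ _.
set B := relative_partition _ _ _ _ _; set T := relative_partition _ _ _ _ _.
set u := fiber_mass _ _ _; set v := fiber_mass _ _ _; set w := fiber_mass _ _ _.
have a0 : 0 < a by apply: expR_gt0.
have b0 : 0 < b by apply: expR_gt0.
move=> l1 h1 l2 h2 l3 h3 lo hi u0 v0 w0.
have aA : 0 <= a * A by rewrite -(pmulr_rge0 _ D0); exact: le_trans l1.
have bB : 0 <= b * B by rewrite -(pmulr_rge0 _ D0); exact: le_trans l2.
have abT : 0 <= a * b * T by rewrite -(pmulr_rge0 _ D0); exact: le_trans l3.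
have DK : D ^+ 3 * D' <= K by rewrite lerDl.
split.
  rewrite -mulrA ler_pdivrMl // -(ler_pM2l (mulr_gt0 a0 b0)).
  apply: (@le_trans _ _ ((D * u) * (D * v))).
    by rewrite mulrACA ler_pM.
  apply: (@le_trans _ _ (D ^+ 2 * (D' * w))).
    by rewrite mulrACA -expr2 ler_wpM2l // exprn_ge0 // ltW.
  apply: (@le_trans _ _ (D ^+ 2 * (D' * (D * (a * b * T))))).
    by rewrite !ler_wpM2l // ?exprn_ge0 // ltW.
  rewrite [leRHS](_ : _ = K * (a * b * T)); last by ring.
  by rewrite [leLHS](_ : _ = D ^+ 3 * D' * (a * b * T)) ?ler_wpM2r //; ring.
rewrite -mulrA -(ler_pM2l (mulr_gt0 a0 b0)); apply: le_trans h3 _.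
apply: (@le_trans _ _ (D * (D' * ((D * (a * A)) * (D * (b * B)))))).
  by rewrite ler_pM2l //; apply: le_trans hi _; rewrite ler_pM2l // ler_pM.
rewrite [leRHS](_ : _ = K * ((a * A) * (b * B))); last by ring.
rewrite [leLHS](_ : _ = D ^+ 3 * D' * ((a * A) * (b * B))); last by ring.
by rewrite ler_wpM2r // mulr_ge0.
Qed.

End Partition.

(** * Concatenation of words and of paths *)

Section Words.
Variables (k l : nat).
Implicit Types (x z : fullshift k) (y : fullshift l) (p : 'I_k.+1 -> 'I_l.+1).

Lemma iter_shift n x i : iter n (@Defs.shift k) x i = x (n + i)%N.
Proof. by elim: n i => [//|n IH] i; rewrite iterS /Defs.shift IH addnS. Qed.

Lemma block_cat n n' x :
  block (n + n') x = cat_tuple (block n x) (block n' (iter n (@Defs.shift k) x)).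
Proof.
apply: eq_from_tnth => i; rewrite tnth_mktuple.
case: (split_ordP i) => j ->; first by rewrite tnth_lshift tnth_mktuple.
by rewrite tnth_rshift tnth_mktuple iter_shift.
Qed.

Lemma map_block n p x : map_tuple p (block n x) = block n (letterwise p x).
Proof. by apply: eq_from_tnth => i; rewrite tnth_map !tnth_mktuple. Qed.

End Words.

Lemma cat_tuple_bij (T : Type) n n' :
  bijective (fun w : n.-tuple T * n'.-tuple T => cat_tuple w.1 w.2).
Proof.
exists (fun w => ([tuple tnth w (lshift n' i) | i < n],
                  [tuple tnth w (rshift n i) | i < n'])).
  move=> [u v] /=; congr (_, _); apply: eq_from_tnth => i.
    by rewrite tnth_mktuple tnth_lshift.
  by rewrite tnth_mktuple tnth_rshift.
move=> w; apply: eq_from_tnth => i /=.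
case: (split_ordP i) => j ->; first by rewrite tnth_lshift tnth_mktuple.
by rewrite tnth_rshift tnth_mktuple.
Qed.

Section Fibers.
Variables (R : realType) (k l : nat) (p : 'I_k.+1 -> 'I_l.+1).
Variables (X : set (fullshift k)) (m : probability (fullshift k) R).

(** A word over y of length n + n' is cut at position n. *)
Lemma fiber_mass_cat n n' (y : fullshift l) :
  fiber_mass p X m (n + n') y =
  \sum_(u : n.-tuple 'I_k.+1 | map_tuple p u == block n y)
   \sum_(v : n'.-tuple 'I_k.+1 |
          map_tuple p v == block n' (iter n (@Defs.shift l) y))
     mass X m (cat_tuple u v).
Proof.
rewrite pair_big /= /fiber_mass (reindex _ (onW_bij _ (@cat_tuple_bij _ n n'))) /=.
apply: eq_bigl => -[u v] /=; rewrite block_cat -!val_eqE /= map_cat eqseq_cat //.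
by rewrite !size_map size_tuple -enumT size_enum_ord.
Qed.

End Fibers.

(** Double counting of the pairs u, u' related by e. *)
Lemma sum_le_multiplicity (R : realFieldType) (W : finType) (P Q : pred W)
    (e : rel W) (F : W -> R) (L : R) (N : nat) :
  0 <= L -> (forall u, 0 <= F u) ->
  (forall u, P u -> exists u', [/\ Q u', e u u' & F u <= L * F u']) ->
  (forall u', (#|[pred u | e u u']| <= N)%N) ->
  \sum_(u | P u) F u <= L * N%:R * \sum_(u | Q u) F u.
Proof.
move=> L0 F0 PQ eN.
apply: (@le_trans _ _ (\sum_(u | P u) \sum_(u' | Q u' && e u u') L * F u')).
  apply: ler_sum => u /PQ[u' [Qu' eu Fu]]; apply: le_trans Fu _.
  rewrite (bigD1 u') /=; last by rewrite Qu'.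
  by rewrite lerDl sumr_ge0 // => i _; rewrite mulr_ge0.
rewrite (exchange_big_dep Q) /=; last by move=> u u' _ /andP[].
rewrite mulr_sumr; apply: ler_sum => u' Qu'.
rewrite sumr_const -[leLHS]mulr_natr [leRHS]mulrAC.
rewrite ler_wpM2l ?mulr_ge0 // ler_nat; apply: leq_trans (eN u').
by apply: subset_leq_card; apply/fintype.subsetP => u; rewrite !inE => /and3P[].
Qed.

(** A word that agrees with u' off a window of K positions is determined by its K
    symbols in the window.  Where the window exceeds the word, the default symbol
    a is read on both sides. *)
Lemma card_agree_off (T : finType) (a : T) n K s (u' : n.-tuple T) :
  (#|[pred u : n.-tuple T | [forall i : 'I_n,
      ~~ (s <= i < s + K)%N ==> (tnth u i == tnth u' i)]]|
    <= #|{: K.-tuple T}|)%N.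
Proof.
pose h (u : n.-tuple T) := [tuple nth a u (s + i) | i < K].
rewrite -(@card_in_image _ _ h); first exact: max_card.
move=> u v; rewrite !inE => /forallP eu /forallP ev huv.
apply: eq_from_tnth => i.
case: (boolP (s <= i < s + K)%N) => [/andP[si iK]|ni].
  have ltK : (i - s < K)%N by rewrite ltn_subLR.
  move/(congr1 (fun w => tnth w (Ordinal ltK))): huv; rewrite !tnth_mktuple /=.
  by rewrite subnKC // !(tnth_nth a).
by move: (eu i) (ev i); rewrite ni /= => /eqP-> /eqP->.
Qed.

Section ShiftOfFiniteType.
Variables (k : nat) (A : 'M[nat]_k.+1).
Implicit Types x z : fullshift k.
Local Notation X := (SFT A).

(** The path x up to time n, followed by z from its beginning. *)
Definition splice n x z : fullshift k :=
  fun i => if (i < n)%N then x i else z (i - n)%N.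

Lemma SFT_iter_shift n x : X x -> X (iter n (@Defs.shift k) x).
Proof. by move=> Xx i; rewrite !iter_shift addnS. Qed.

Lemma SFT_splice n x z : X x -> X z -> x n = z 0%N -> X (splice n x z).
Proof.
move=> Xx Xz e i; rewrite /splice.
case: (ltngtP i.+1 n) => [lt|gt|eq].
- exact: Xx.
- by rewrite subSn.
- by rewrite -eq subnn -e -eq.
Qed.

Lemma measurable_SFT : measurable (X : set (fullshift k)).
Proof.
rewrite (_ : SFT A = \bigcap_n \bigcup_(a in [set: 'I_k.+1])
    ([set x : fullshift k | x n = a] `&`
     [set x : fullshift k | A a (x n.+1) = 1%N])).
  apply: bigcapT_measurable => n; apply: fin_bigcup_measurable => // a _.
  apply: measurableI; first exact: (@measurable_coord k n [set a]).
  exact: (@measurable_coord k n.+1 [set b | A a b = 1%N]).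
apply/seteqP; split => [x Xx n _|x H n].
  by exists (x n) => //; split => //; exact: Xx.
by have [a _ [/= -> ->]] := H n I.
Qed.

End ShiftOfFiniteType.

(** * Quasi-Bernoulli measures and detours inside a fiber *)

Section QuasiBernoulli.
Variables (R : realType) (k : nat) (X : set (fullshift k)).
Variables (m : probability (fullshift k) R).

Definition quasi_bernoulli (D : R) := forall n n' x, X x ->
  mass X m (block (n + n') x) <=
    D * (mass X m (block n x) * mass X m (block n' (iter n (@Defs.shift k) x))) /\
  mass X m (block n x) * mass X m (block n' (iter n (@Defs.shift k) x)) <=
    D * mass X m (block (n + n') x).

Lemma birkhoff_add (f : fullshift k -> R) n n' x :
  birkhoff f (n + n') x =
  birkhoff f n x + birkhoff f n' (iter n (@Defs.shift k) x).
Proof.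
rewrite /birkhoff big_split_ord /=; congr (_ + _).
by apply: eq_bigr => i _; rewrite -iterD addnC.
Qed.

(** Birkhoff sums are additive along orbits, so that the Gibbs inequalities for the
    two factors multiply to those for the whole block. *)
Lemma gibbs_quasi_bernoulli f : (forall x, X x -> X (Defs.shift x)) ->
  gibbs X f m -> exists D, 1 <= D /\ quasi_bernoulli D.
Proof.
move=> sX /gibbs_mass[P [D [D1 g]]]; exists (D ^+ 3).
have D0 : 0 < D by apply: lt_le_trans D1.
split; first exact: exprn_ege1.
move=> n n' x Xx.
have Xs : X (iter n (@Defs.shift k) x) by elim: n => //= n IH; exact: sX.
have [l1 h1] := g n x Xx; have [l2 h2] := g n' _ Xs.
have [l3 h3] := g (n + n')%N x Xx.
have e : expR (- (n + n')%:R * P + birkhoff f (n + n') x) =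
    expR (- n%:R * P + birkhoff f n x) *
    expR (- n'%:R * P + birkhoff f n' (iter n (@Defs.shift k) x)).
  by rewrite -expRD birkhoff_add natrD; congr expR; ring.
move: l1 h1 l2 h2 l3 h3; rewrite e !ler_pdivrMl //.
set a := expR _; set b := expR _.
have a0 : 0 <= a by apply: expR_ge0.
have b0 : 0 <= b by apply: expR_ge0.
have := mass_ge0 X m (block n x).
have := mass_ge0 X m (block n' (iter n (@Defs.shift k) x)).
have := mass_ge0 X m (block (n + n') x).
set M := mass _ _ _; set u := mass _ _ _; set v := mass _ _ _.
move=> M0 u0 v0 l1 h1 l2 h2 l3 h3; split.
  apply: le_trans h3 _; rewrite exprS expr2 -mulrA ler_pM2l //.
  by rewrite mulrACA ler_pM.
apply: (@le_trans _ _ ((D * a) * (D * b))); first by rewrite ler_pM.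
rewrite mulrACA -expr2 [leRHS](_ : _ = D ^+ 2 * (D * M)); last by ring.
by rewrite ler_wpM2l // exprn_ge0 // ltW.
Qed.

Lemma mass_le1 n (w : n.-tuple 'I_k.+1) : measurable X -> mass X m w <= 1.
Proof.
move=> mX; rewrite /mass -lee_fin fineK ?fin_num_measure //; last first.
  exact: measurable_cylinder.
by apply: probability_le1; exact: measurable_cylinder.
Qed.

(** The blocks of length at most K have positive mass and are finite in number: M
    dominates the inverses of their masses.  Words of mass 0 contribute 0 to M,
    as the inverse of 0 is 0. *)
Lemma mass_short_lower f K : measurable X -> gibbs X f m ->
  exists M : R, 1 <= M /\ forall j x, (j <= K)%N -> X x ->
    1 <= M * mass X m (block j x).
Proof.
move=> mX /gibbs_mass[P [D [D1 g]]].
pose S j := \sum_(w : j.-tuple 'I_k.+1) (mass X m w)^-1.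
have S0 j : 0 <= S j by apply: sumr_ge0 => w _; rewrite invr_ge0 mass_ge0.
exists (1 + \sum_(j < K.+1) S j); split; first by rewrite lerDl sumr_ge0.
move=> j x; rewrite -ltnS => jK Xx.
have pos : 0 < mass X m (block j x).
  apply: lt_le_trans (g j x Xx).1.
  by rewrite mulr_gt0 ?expR_gt0 // invr_gt0 (lt_le_trans _ D1).
rewrite -ler_pdivrMr // div1r.
apply: (@le_trans _ _ (S j)).
  rewrite /S (bigD1 (block j x)) //= lerDl.
  by apply: sumr_ge0 => w _; rewrite invr_ge0 mass_ge0.
rewrite (bigD1 (Ordinal jK)) //=.
have : 0 <= \sum_(i < K.+1 | i != Ordinal jK) S i by apply: sumr_ge0.
by move: (S j) => s; lra.
Qed.

(** Both masses are, up to the factor D, the product of the mass of the common part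
    and of the mass of the part of length at most K, and the latter lies between
    1 / M and 1. *)
Lemma mass_change (D M : R) K n a b x z : n = (a + b)%N ->
  measurable X -> 1 <= D -> 0 <= M -> quasi_bernoulli D ->
  (forall j x, (j <= K)%N -> X x -> 1 <= M * mass X m (block j x)) ->
  X x -> X z ->
  (b <= K)%N /\ block a x = block a z \/
  (a <= K)%N /\
    block b (iter a (@Defs.shift k) x) = block b (iter a (@Defs.shift k) z) ->
  (forall x, X x -> X (Defs.shift x)) ->
  mass X m (block n x) <= D ^+ 2 * M * mass X m (block n z).
Proof.
move=> -> mX D1 M0 qb short Xx Xz agree sX.
have Xs u : X u -> X (iter a (@Defs.shift k) u).
  by move=> Xu; elim: a {agree} => //= i IH; exact: sX.
have [h _] := qb a b x Xx; have [_ l] := qb a b z Xz.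
apply: le_trans h _; rewrite expr2 -!mulrA ler_pM2l ?(lt_le_trans _ D1) //.
rewrite mulrCA; apply: (@le_trans _ _ (M * (mass X m (block a z) *
    mass X m (block b (iter a (@Defs.shift k) z))))); last exact: ler_wpM2l.
have le1 := mass_le1 _ mX.
case: agree => -[leK e]; rewrite e.
  rewrite mulrCA ler_wpM2l ?mass_ge0 //.
  by apply: le_trans (le1 _ _) _; apply: short => //; exact: Xs.
rewrite mulrA ler_wpM2r ?mass_ge0 //.
by apply: le_trans (le1 _ _) _; exact: short.
Qed.

End QuasiBernoulli.

Section Detours.
Variables (k l : nat) (A : 'M[nat]_k.+1) (Y : set (fullshift l)).
Variables (p : 'I_k.+1 -> 'I_l.+1) (q : nat).
Local Notation X := (SFT A).
Hypothesis factor : one_block_factor p X Y.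
Hypothesis mixing : forall w : q.+1.-tuple 'I_l.+1, blocks Y w ->
  forall u v : q.+1.-tuple 'I_k.+1, blocks X u -> blocks X v ->
    map_tuple p u = w -> map_tuple p v = w ->
    exists a : q.+1.-tuple 'I_k.+1,
      [/\ blocks X a, tnth a ord0 = tnth u ord0,
          tnth a ord_max = tnth v ord_max & map_tuple p a = w].

(** The mixing property, read on paths instead of blocks. *)
Lemma detour x z : X x -> X z -> (forall i, (i <= q)%N -> p (x i) = p (z i)) ->
  exists t, [/\ X t, t 0%N = x 0%N, t q = z q &
    forall i, (i <= q)%N -> p (t i) = p (z i)].
Proof.
move=> Xx Xz e.
have Yz : Y (letterwise p z) by case: factor => _ <- _; exists z.
have [|||||a [[t Xt <-]]] := @mixing (block q.+1 (letterwise p z)) _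
    (block q.+1 x) (block q.+1 z).
- by exists (letterwise p z).
- by exists x.
- by exists z.
- by rewrite map_block; apply/eq_block => i; rewrite ltnS => /e.
- by rewrite map_block.
rewrite !tnth_mktuple map_block => t0 tq /eq_block pt.
by exists t; split => // i iq; exact: pt.
Qed.

(** A detour over the last q + 1 positions leads from x to z, and z is followed from
    then on.  For n <= q no symbol of x has to be kept, and z itself will do. *)
Lemma rejoin n x z : X x -> X z -> (forall i, (i < n)%N -> p (x i) = p (z i)) ->
  exists t, [/\ X t, forall i, (i < n - q.+1)%N -> t i = x i, t n = z n &
    forall i, p (t i) = p (z i)].
Proof.
move=> Xx Xz e; case: (ltnP n q.+1) => [ltnq|leqn].
  by exists z; split => // i; rewrite (eqP (ltnW ltnq : (n - q.+1 == 0)%N)).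
set s := (n - q.+1)%N.
have es : (s + q).+1 = n by rewrite -addnS subnK.
have [||i iq|t [Xt t0 tq pt]] := @detour (iter s (@Defs.shift k) x)
    (iter s (@Defs.shift k) z).
- exact: SFT_iter_shift.
- exact: SFT_iter_shift.
- by rewrite !iter_shift e // -es ltnS leq_add2l.
rewrite !iter_shift addn0 in t0 tq.
pose t' := splice s x t.
have Xt' : X t' by apply: SFT_splice.
exists (splice (s + q) t' (iter (s + q) (@Defs.shift k) z)); split.
- apply: SFT_splice => //; first exact: SFT_iter_shift.
  by rewrite iter_shift addn0 /t' /splice ltnNge leq_addr /= addKn.
- by move=> i lti; rewrite /splice (leq_trans lti (leq_addr _ _)) /t' /splice lti.
- by rewrite /splice ltnNge -es leqnSn /= iter_shift subnKC.
move=> i; rewrite /splice; case: ltnP => [ltsq|lesq]; last first.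
  by rewrite iter_shift subnKC.
rewrite /t' /splice; case: ltnP => [lts|les].
  by rewrite e // -es ltnS ltnW.
by rewrite pt ?iter_shift ?subnKC // leq_subLR ltnW.
Qed.

(** The mirror image of [rejoin]: a detour over the first q + 1 positions leads from
    z to x.  For n <= q, z itself will do. *)
Lemma depart n x z : X x -> X z -> (forall i, (i < n)%N -> p (x i) = p (z i)) ->
  exists t, [/\ X t, forall i, (q < i < n)%N -> t i = x i, t 0%N = z 0%N &
    forall i, (i < n)%N -> p (t i) = p (z i)].
Proof.
move=> Xx Xz e; case: (ltnP n q.+1) => [ltnq|leqn].
  exists z; split => // i /andP[qi ltin].
  by move: (ltn_trans qi ltin); rewrite ltnNge -ltnS ltnq.
have [i iq|t [Xt t0 tq pt]] := @detour z x Xz Xx.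
  by rewrite e // (leq_ltn_trans iq).
exists (splice q t (iter q (@Defs.shift k) x)); split.
- by apply: SFT_splice => //; [exact: SFT_iter_shift|rewrite iter_shift addn0].
- by move=> i /andP[qi _]; rewrite /splice ltnNge (ltnW qi) /= iter_shift subnKC // ltnW.
- rewrite /splice; case: ltnP => // /[!leqn0]/eqP q0.
  by rewrite iter_shift subnKC ?q0 // -t0; move: tq; rewrite q0.
move=> i ltin; rewrite /splice; case: ltnP => [ltiq|leqi].
  by rewrite pt ?e // ltnW.
by rewrite iter_shift subnKC // e.
Qed.

End Detours.

(** * Fiber-wise mixing implies almost additivity *)

Lemma sum_subset_le (R : numDomainType) (W : finType) (P Q : pred W) (F : W -> R) :
  (forall u, 0 <= F u) -> (forall u, P u -> Q u) ->
  \sum_(u | P u) F u <= \sum_(u | Q u) F u.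
Proof.
move=> F0 PQ; rewrite [leLHS]big_mkcond [leRHS]big_mkcond /=.
by apply: ler_sum => u _; case: ifP => [/PQ->//|_]; case: ifP.
Qed.

(** The upper bound is the inequality mass uv <= D * mass u * mass v, summed over
    the words u and v.  In the lower bound, J^2 pays for the replacement of the
    words by words that meet z at time n, and D for their concatenation. *)
Lemma mixing_almost_additive (R : realType) (k l : nat) (A : 'M[nat]_k.+1)
    (Y : set (fullshift l)) (p : 'I_k.+1 -> 'I_l.+1) (f : fullshift k -> R)
    (m : probability (fullshift k) R) :
  one_block_factor p (SFT A) Y -> gibbs (SFT A) f m ->
  fiberwise_sub_positive_mixing p (SFT A) Y ->
  almost_additive Y (relative_partition p (SFT A) f).
Proof.
move=> factor gm [q mixing]; apply: (almost_additive_fiber_mass gm).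
have mX := measurable_SFT A.
set X := SFT A in factor gm mixing mX *.
have sX x : X x -> X (Defs.shift x) by move=> Xx i; exact: Xx.
have [D [D1 qb]] := gibbs_quasi_bernoulli sX gm.
have [M [M1 short]] := mass_short_lower q.+1 mX gm.
have D0 : 0 < D by apply: lt_le_trans D1.
have M0 : 0 <= M by apply: le_trans M1.
pose N := #|{: q.+1.-tuple 'I_k.+1}|.
pose L := D ^+ 2 * M.
have L0 : 0 <= L by rewrite mulr_ge0 // exprn_ge0 // ltW.
pose J := L * N%:R.
have J0 : 0 <= J by rewrite mulr_ge0.
have F0 n (w : n.-tuple 'I_k.+1) := mass_ge0 X m w.
exists (J ^+ 2 * D + D); split.
  by rewrite ltr_wpDl // mulr_ge0 ?exprn_ge0 // ltW.
move=> y n n' Yy; set y' := iter n _ y.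
rewrite fiber_mass_cat -/y'; split; last first.
  apply: (@le_trans _ _ (D * (fiber_mass p X m n y * fiber_mass p X m n' y'))).
    rewrite /fiber_mass big_distrlr mulr_sumr; apply: ler_sum => u pu.
    rewrite mulr_sumr; apply: ler_sum => v pv.
    case: (pselect (blocks X (cat_tuple u v))) => [[x Xx]|nX].
      rewrite block_cat => /(bij_inj (@cat_tuple_bij _ n n') (x1 := (_, _)) (x2 := (_, _))).
      by case=> <- <-; rewrite -block_cat; exact: (qb n n' x Xx).1.
    rewrite [mass _ _ (cat_tuple u v)](_ : _ = 0) ?mulr_ge0 ?F0 ?(ltW D0) //.
    rewrite /mass (_ : cylinder X _ = set0) ?measure0 //.
    by apply/seteqP; split => // x [Xx xw]; apply: nX; exists x.
  rewrite ler_wpM2r ?lerDr ?mulr_ge0 ?exprn_ge0 ?(ltW D0) //;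
    by apply: sumr_ge0 => w _.
(* The path z is the bridge between words on both sides of time n. *)
have [z Xz zy] : exists2 z, X z & letterwise p z = y.
  by case: factor => _ XY _; move: Yy; rewrite -XY => -[z Xz e]; exists z.
have zi i : p (z i) = y i by rewrite -zy.
(* Q1: the words over y that lead to z at time n; Q2: those that leave from it. *)
pose Q1 := [pred w : n.-tuple 'I_k.+1 | `[< exists t,
  [/\ X t, block n t = w, map_tuple p w = block n y & t n = z n] >]].
pose Q2 := [pred w : n'.-tuple 'I_k.+1 | `[< exists t,
  [/\ X t, block n' t = w, map_tuple p w = block n' y' & t 0%N = z n] >]].
have sum1 : fiber_mass p X m n y <= J * \sum_(u | Q1 u) mass X m u.
  rewrite fiber_mass_blocks; apply: (sum_le_multiplicity L0 (F0 _) _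
    (@card_agree_off _ ord0 n q.+1 (n - q.+1))).
  move=> u /andP[/eqP pu /asboolP[x Xx e]]; subst u.
  have ex i : (i < n)%N -> p (x i) = p (z i).
    by move: pu; rewrite map_block => /eq_block e /e; rewrite zi.
  have [t [Xt tx tz pt]] := rejoin factor mixing Xx Xz ex.
  have pt' : map_tuple p (block n t) = block n y.
    by rewrite map_block; apply/eq_block => i _; rewrite -zi -pt.
  exists (block n t); split.
  - by apply/asboolP; exists t.
  - apply/forallP => i; apply/implyP; rewrite !tnth_mktuple => ni.
    rewrite tx //; move: ni; rewrite negb_and -!ltnNge => /orP[//|].
    rewrite ltnS; have := ltn_ord i; case: (leqP q.+1 n) => [le|lt].
      by rewrite subnK // => lti; rewrite leqNgt lti.
    by rewrite (eqP (ltnW lt : (n - q.+1 == 0)%N)) add0n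
      => lti /(leq_trans lt); rewrite ltnNge (ltnW lti).
  - apply: (@mass_change _ _ X m D M q.+1 n (n - q.+1) (n - (n - q.+1))) => //.
      by rewrite subnKC // leq_subr.
    by left; split; [rewrite leq_subCl|apply/eq_block => i /tx].
have sum2 : fiber_mass p X m n' y' <= J * \sum_(u | Q2 u) mass X m u.
  rewrite fiber_mass_blocks; apply: (sum_le_multiplicity L0 (F0 _) _
    (@card_agree_off _ ord0 n' q.+1 0)).
  move=> u /andP[/eqP pu /asboolP[x Xx e]]; subst u.
  have ex i : (i < n')%N -> p (x i) = p (iter n (@Defs.shift k) z i).
    move: pu; rewrite map_block => /eq_block e /e.
    by rewrite iter_shift zi -(iter_shift n y).
  have [t [Xt tx tz pt]] := depart factor mixing Xx (SFT_iter_shift n Xz) ex.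
  have pt' : map_tuple p (block n' t) = block n' y'.
    rewrite map_block; apply/eq_block => i lti.
    by rewrite [LHS]pt // /y' !iter_shift zi.
  exists (block n' t); split.
  - by apply/asboolP; exists t; split => //; rewrite tz iter_shift addn0.
  - apply/forallP => i; apply/implyP; rewrite !tnth_mktuple leq0n add0n /= -leqNgt => qi.
    by rewrite tx // qi ltn_ord.
  - apply: (@mass_change _ _ X m D M q.+1 n' (minn n' q.+1) (n' - minn n' q.+1)) => //.
      by rewrite subnKC // geq_minl.
    right; split; first exact: geq_minr.
    apply/eq_block => i; rewrite !iter_shift ltn_subRL => lti; apply/esym/tx.
    rewrite lti andbT; move: lti; rewrite /minn; case: (ltnP n' q.+1) => [_|_ _].
      by rewrite ltnNge leq_addr.
    exact: leq_addr.
apply: (@le_trans _ _ ((J * \sum_(u | Q1 u) mass X m u) *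
                       (J * \sum_(u | Q2 u) mass X m u))).
  by rewrite ler_pM // sumr_ge0.
apply: (@le_trans _ _ (J ^+ 2 * (D * \sum_(u | Q1 u) \sum_(v | Q2 v)
    mass X m (cat_tuple u v)))).
  rewrite mulrACA -expr2 ler_wpM2l ?exprn_ge0 // big_distrlr mulr_sumr.
  apply: ler_sum => u /asboolP[t [Xt <- _ tn]].
  rewrite mulr_sumr; apply: ler_sum => v /asboolP[s [Xs <- _ s0]].
  (* Words in Q1 and Q2 compose, as they meet in the symbol z n. *)
  have Xg : X (splice n t s) by apply: SFT_splice => //; rewrite tn s0.
  have -> : block n t = block n (splice n t s).
    by apply/eq_block => i lti; rewrite /splice lti.
  have -> : block n' s = block n' (iter n (@Defs.shift k) (splice n t s)).
    by apply/eq_block => i _; rewrite iter_shift /splice ltnNge leq_addr /= addKn.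
  by rewrite -block_cat; exact: (qb n n' _ Xg).2.
rewrite mulrA; apply: (@le_trans _ _ (J ^+ 2 * D *
    \sum_(u : n.-tuple 'I_k.+1 | map_tuple p u == block n y)
    \sum_(v : n'.-tuple 'I_k.+1 | map_tuple p v == block n' y')
      mass X m (cat_tuple u v))).
  rewrite ler_wpM2l ?mulr_ge0 ?exprn_ge0 ?(ltW D0) //.
  apply: (@le_trans _ _ (\sum_(u | Q1 u)
    \sum_(v : n'.-tuple 'I_k.+1 | map_tuple p v == block n' y')
      mass X m (cat_tuple u v))).
    apply: ler_sum => u _; apply: sum_subset_le => // v.
    by move=> /asboolP[t [_ _ /eqP]].
  apply: sum_subset_le => u; first by rewrite sumr_ge0.
  by move=> /asboolP[t [_ _ /eqP]].
by rewrite ler_wpM2r ?lerDl ?(ltW D0) // sumr_ge0 // => u _; rewrite sumr_ge0.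
Qed.

(** * Balanced functions on binary words *)

Section BinaryAverages.
Variable R : realType.
Implicit Types (F G : seq bool -> R) (s u v : seq bool).

(** The mean of F over the binary words of length n, by recursion on the first letter
    so that linearity, monotonicity and Fubini are immediate inductions. *)
Fixpoint bavg n F : R :=
  if n is n'.+1 then
    (bavg n' (fun v => F (false :: v)) + bavg n' (fun v => F (true :: v))) / 2
  else F [::].

Lemma eq_bavg n F G : (forall v, size v = n -> F v = G v) -> bavg n F = bavg n G.
Proof.
elim: n F G => [|n IH] F G FG /=; first exact: FG.
by congr ((_ + _) / _); apply: IH => v sv; apply: FG; rewrite /= sv.
Qed.

Lemma bavgD n F G : bavg n (fun v => F v + G v) = bavg n F + bavg n G.
Proof. by elim: n F G => [//|n IH] F G /=; rewrite !IH; ring. Qed.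

Lemma bavgZ n c F : bavg n (fun v => c * F v) = c * bavg n F.
Proof. by elim: n F => [//|n IH] F /=; rewrite !IH; ring. Qed.

Lemma bavg_cst n c : bavg n (fun=> c) = c.
Proof. by elim: n => [//|n IH] /=; rewrite !IH; field. Qed.

Lemma le_bavg n F G :
  (forall v, size v = n -> F v <= G v) -> bavg n F <= bavg n G.
Proof.
elim: n F G => [|n IH] F G FG /=; first exact: FG.
by rewrite ler_pM2r ?invr_gt0 // lerD // IH // => v sv; apply: FG; rewrite /= sv.
Qed.

Lemma bavg_cat n n' F :
  bavg (n + n') F = bavg n (fun u => bavg n' (fun v => F (u ++ v))).
Proof. by elim: n F => [//|n IH] F; rewrite addSn /= !IH. Qed.

Lemma exchange_bavg n n' (F : seq bool -> seq bool -> R) :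
  bavg n (fun u => bavg n' (F u)) = bavg n' (fun v => bavg n (F^~ v)).
Proof.
elim: n F => [//|n IH] F /=; rewrite !IH -bavgD mulrC -bavgZ.
by apply: eq_bavg => v _; rewrite mulrC.
Qed.

Lemma bavg_eq0 n F : (forall v, 0 <= F v) -> bavg n F <= 0 ->
  forall v, size v = n -> F v = 0.
Proof.
elim: n F => [|n IH] F F0 /= le0.
  by move=> v /size0nil ->; apply/eqP; rewrite eq_le le0 F0.
have ge0 b : 0 <= bavg n (fun v => F (b :: v)).
  by rewrite -(bavg_cst n 0); apply: le_bavg => v _; exact: F0.
move: (ge0 false) (ge0 true) => g0 g1.
case=> // b v [sv]; apply: (IH (fun v => F (b :: v))) => //.
by case: b; lra.
Qed.

(** For a shift-invariant measure nu, the function r(s) = 2^n nu[s] on words s of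
    length n satisfies [r_cons] by invariance and [r_rcons] by additivity. *)
Variable r : seq bool -> R.
Hypothesis r_nil : r [::] = 1.
Hypothesis r_cons : forall s, r s = (r (false :: s) + r (true :: s)) / 2.
Hypothesis r_rcons : forall s, r s = (r (rcons s false) + r (rcons s true)) / 2.

Lemma bavg_prefix n s : bavg n (fun v => r (s ++ v)) = r s.
Proof.
elim: n s => [|n IH] s /=; first by rewrite cats0.
by rewrite [RHS]r_rcons -!IH; congr ((_ + _) / _);
  apply: eq_bavg => v _; rewrite cat_rcons.
Qed.

Lemma bavg_suffix n s : bavg n (fun v => r (v ++ s)) = r s.
Proof.
elim: n => [//|n IH] /=; rewrite -{}[RHS]IH -bavgD mulrC -bavgZ.
by apply: eq_bavg => v _; rewrite [RHS]r_cons mulrC.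
Qed.

Let A n := bavg n (fun u => r u ^+ 2).

(** Let u and v be independent uniform words of length n, with expectation E.  As r
    is a mean over extensions on either side, r(u) and r(v) are orthogonal
    projections of r(uv), so that E (r(uv) - r(u))^2 and E (r(uv) - r(v))^2 both
    equal A(2n) - A(n).  By independence and E r = 1, E (r(u) - r(v))^2 equals
    2 A(n) - 2.  It remains to apply (a - b)^2 <= 2 (c - a)^2 + 2 (c - b)^2. *)
Lemma second_moment_doubling n : 2 * A n - 2 <= 4 * (A (n + n) - A n).
Proof.
have e1 : bavg n (fun u => bavg n (fun v => (r (u ++ v) - r u) ^+ 2)) =
    A (n + n) - A n.
  rewrite /A bavg_cat -mulN1r -bavgZ -bavgD; apply: eq_bavg => u _.
  transitivity (bavg n (fun v => r (u ++ v) ^+ 2 +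
      ((- 2 * r u) * r (u ++ v) + r u ^+ 2))).
    by apply: eq_bavg => v _; ring.
  by rewrite bavgD bavgD bavgZ bavg_cst bavg_prefix; ring.
have e2 : bavg n (fun u => bavg n (fun v => (r (u ++ v) - r v) ^+ 2)) =
    A (n + n) - A n.
  rewrite /A bavg_cat exchange_bavg [in RHS]exchange_bavg -mulN1r -bavgZ -bavgD.
  apply: eq_bavg => v _.
  transitivity (bavg n (fun u => r (u ++ v) ^+ 2 +
      ((- 2 * r v) * r (u ++ v) + r v ^+ 2))).
    by apply: eq_bavg => u _; ring.
  by rewrite bavgD bavgD bavgZ bavg_cst bavg_suffix; ring.
have mean : bavg n (fun v => r v) = 1 by rewrite -r_nil -(bavg_prefix n [::]).
have e3 : bavg n (fun u => bavg n (fun v => (r u - r v) ^+ 2)) = 2 * A n - 2.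
  transitivity (bavg n (fun u => r u ^+ 2 + ((- 2) * r u + A n))).
    apply: eq_bavg => u _.
    transitivity (bavg n (fun v => r u ^+ 2 + ((- 2 * r u) * r v + r v ^+ 2))).
      by apply: eq_bavg => v _; ring.
    by rewrite !bavgD bavg_cst bavgZ mean mulr1.
  by rewrite !bavgD bavg_cst (bavgZ n (-2)) mean -/(A n); ring.
rewrite -e3 [leRHS](_ : _ = 2 * (A (n + n) - A n) + 2 * (A (n + n) - A n)); last by ring.
rewrite -{1}e1 -e2 -!bavgZ -bavgD; apply: le_bavg => u _.
rewrite -!bavgZ -bavgD; apply: le_bavg => v _.
have := sqr_ge0 (r (u ++ v) * 2 - r u - r v).
by rewrite !expr2; nra.
Qed.

(** The variance of r on words of length n is A(n) - 1.  By [second_moment_doubling]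
    it is multiplied by at least 3/2 when n doubles, which is compatible with the
    boundedness of r only if it is 0. *)
Lemma bounded_balanced_eq1 C : (forall s, (1 < size s)%N -> `|r s| <= C) ->
  forall s, r s = 1.
Proof.
move=> rC s; set n := size s.
have Avar : bavg n (fun u => (r u - 1) ^+ 2) = A n - 1.
  transitivity (bavg n (fun u => r u ^+ 2 + ((- 2) * r u + 1))).
    by apply: eq_bavg => u _; ring.
  rewrite !bavgD bavg_cst (bavgZ n (-2)) -/(A n).
  by rewrite [bavg n _](@bavg_prefix n [::]) r_nil; ring.
suff A1 : A n - 1 <= 0.
  have /(_ s erefl) : forall u, size u = n -> (r u - 1) ^+ 2 = 0.
    by apply: (@bavg_eq0 _ (fun u => (r u - 1) ^+ 2));
      [move=> u; exact: sqr_ge0|rewrite Avar].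
  by move/eqP; rewrite sqrf_eq0 subr_eq0 => /eqP.
rewrite leNgt; apply/negP => A0.
have n0 : (0 < n)%N.
  by rewrite lt0n; apply/eqP => n0; move: A0; rewrite n0 /A /= r_nil expr1n subrr ltxx.
have grow j : (1 + j%:R / 2) * (A n - 1) <= A (2 ^ j * n)%N - 1.
  elim: j => [|j IH]; first by rewrite mul0r addr0 mul1r expn0 mul1n.
  have := second_moment_doubling (2 ^ j * n); rewrite addnn -muln2 mulnAC -expnSr.
  have j0 : 0 <= j%:R :> R by rewrite ler0n.
  have := mulr_ge0 j0 (ltW A0).
  move: IH; rewrite -[j.+1%:R]natr1.
  move: (A (2 ^ j * n)%N) (A (2 ^ j.+1 * n)%N) (j%:R) j0 => a b t t0; nra.
(* By Bernoulli's inequality (3/2)^j >= 1 + j/2, and this j makes the product with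
   the variance exceed C^2. *)
pose j := (Num.truncn (2 * C ^+ 2 / (A n - 1))).+1.
have := grow j.
have long v : size v = (2 ^ j * n)%N -> (1 < size v)%N.
  by move->; rewrite /j expnS -mulnA leq_pmulr // muln_gt0 expn_gt0.
have Aj : A (2 ^ j * n)%N <= C ^+ 2.
  rewrite -(bavg_cst (2 ^ j * n) (C ^+ 2)); apply: le_bavg => v sv.
  rewrite -[leLHS]real_normK ?num_real // lerXn2r ?nnegrE //.
    by apply: le_trans (rC v (long v sv)).
  exact: rC (long v sv).
have : 2 * C ^+ 2 / (A n - 1) < j%:R by rewrite /j truncnS_gt.
rewrite ltr_pdivrMr //.
move: (A n - 1) A0 (j%:R) (C ^+ 2) Aj => a a0 t c; nra.
Qed.

End BinaryAverages.

(** * The edge shift of the complete graph with two vertices *)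

Section EdgeShift.

(** The symbol 2 b + c stands for the edge from the vertex b to the vertex c. *)
Definition hi (a : 'I_4) : bool := (1 < a)%N.
Definition lo (a : 'I_4) : bool := odd a.
Definition edge (b c : bool) : 'I_4 := inord (b.*2 + c).

Lemma hi_edge b c : hi (edge b c) = b.
Proof. by rewrite /hi inordK; case: b; case: c. Qed.

Lemma lo_edge b c : lo (edge b c) = c.
Proof. by rewrite /lo inordK; case: b; case: c. Qed.

Lemma edge_hi_lo a : edge (hi a) (lo a) = a.
Proof.
by apply: val_inj; rewrite /edge /hi /lo; case: a => -[|[|[|[|?]]]] //= _; rewrite inordK.
Qed.

Lemma hi_lo_inj a b : hi a = hi b -> lo a = lo b -> a = b.
Proof. by move=> ehi elo; rewrite -(edge_hi_lo a) ehi elo edge_hi_lo. Qed.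

Definition edge_matrix : 'M[nat]_4 := \matrix_(a, b) (lo a == hi b : nat).

Local Notation X := (SFT edge_matrix : set (fullshift 3)).

Lemma edge_shiftP x : X x <-> forall n, lo (x n) = hi (x n.+1).
Proof.
split=> H n; last by rewrite mxE H eqxx.
by have := H n; rewrite mxE; case: eqP.
Qed.

(** Between any two edges there is exactly one path with one edge in between. *)
Lemma mixing_edge_shift : mixing_SFT X.
Proof.
exists edge_matrix; split => //.
  by move=> a b; rewrite mxE; case: (_ == _); [right|left].
exists 2%N; split => // a b.
rewrite expr2 -mulmxE mxE (bigD1 (edge (lo a) (hi b))) //=.
by rewrite !mxE hi_edge lo_edge !eqxx.
Qed.

Definition edge_path (s : nat -> bool) : fullshift 3 :=
  fun i => edge (s i) (s i.+1).

Lemma edge_pathX s : X (edge_path s).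
Proof. by apply/edge_shiftP => n; rewrite lo_edge hi_edge. Qed.

Definition vertex_cylinder (s : seq bool) : set (fullshift 3) :=
  [set x | forall i, (i < size s)%N -> hi (x i) = nth false s i].

Lemma measurable_vertex_cylinder s : measurable (vertex_cylinder s).
Proof.
rewrite (_ : vertex_cylinder s = \bigcap_i
    [set x : fullshift 3 | (i < size s)%N -> hi (x i) = nth false s i]).
  apply: bigcapT_measurable => i.
  exact: (@measurable_coord 3 i
    [set a | (i < size s)%N -> hi a = nth false s i]).
by apply/seteqP; split => x Hx i; [move=> _; exact: Hx|exact: Hx].
Qed.

Lemma vertex_cylinder_mkseq f n x :
  vertex_cylinder (mkseq f n) x <-> forall i, (i < n)%N -> hi (x i) = f i.
Proof.
rewrite /vertex_cylinder /= size_mkseq; split => H i ltin; have := H i ltin;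
  by rewrite nth_mkseq.
Qed.

(** A path with n edges passes through n + 1 vertices, except that the empty block
    records no vertex. *)
Lemma cylinder_edge_shift n x : X x ->
  cylinder X (block n x) =
  X `&` vertex_cylinder (mkseq (fun i => hi (x i)) (if n is 0 then 0 else n.+1)).
Proof.
move=> Xx; have /edge_shiftP ex := Xx; apply/seteqP; split => z [Xz].
  move=> /eq_block e; split => //; have /edge_shiftP ez := Xz.
  apply/vertex_cylinder_mkseq; case: n e => [//|n] e [_|i]; first by rewrite e.
  by rewrite ltnS => lti; rewrite -ez -ex e.
move=> /vertex_cylinder_mkseq e; split => //; have /edge_shiftP ez := Xz.
apply/eq_block => i; case: n e => [//|n] e lti; apply: hi_lo_inj.
  by rewrite e // ltnW.
by rewrite ez ex e.
Qed.

Section Measures.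
Variables (R : realType).
Implicit Types m : probability (fullshift 3) R.

Lemma probability_setI_full m (B : set (fullshift 3)) : m X = 1%E ->
  measurable B -> m (X `&` B) = m B.
Proof.
move=> mX mB; have mXX := measurable_SFT edge_matrix.
rewrite [RHS](measureDI m mB mXX) [in RHS]setIC [Z in (Z + _)%E](_ : _ = 0%E) ?add0e //.
apply/eqP; rewrite eq_le measure_ge0 andbT.
apply: (@le_trans _ _ (m (~` X))).
  by apply: le_measure; rewrite ?inE; [exact: measurableD|exact: measurableC|move=> x []].
by rewrite probability_setC // mX subee.
Qed.

(** On paths, the cylinders of edges are cylinders of vertices. *)
Lemma eq_measure_edge_shift m1 m2 : m1 X = 1%E -> m2 X = 1%E ->
  (forall s, m1 (vertex_cylinder s) = m2 (vertex_cylinder s)) ->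
  forall B, measurable B -> m1 B = m2 B.
Proof.
move=> m1X m2X e; apply: eq_measure_cylinders => n w.
have mw := measurable_cylinder w (@measurableT _ (fullshift 3)).
rewrite -(probability_setI_full m1X mw) -(probability_setI_full m2X mw).
have -> : X `&` cylinder setT w = cylinder X w.
  by apply/seteqP; split => x; [case=> Xx []|case].
case: (pselect (blocks X w)) => [[x Xx <-]|nX].
  rewrite cylinder_edge_shift // !probability_setI_full //;
    exact: measurable_vertex_cylinder.
rewrite (_ : cylinder X w = set0) ?measure0 //.
by apply/seteqP; split => // x [Xx xw]; apply: nX; exists x.
Qed.

Lemma vertex_cylinder_shift m s :
  m (@Defs.shift 3 @^-1` vertex_cylinder s) =
  (m (vertex_cylinder (false :: s)) + m (vertex_cylinder (true :: s)))%E.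
Proof.
rewrite -measureU; [|exact: measurable_vertex_cylinder..|].
  congr (m _); apply/seteqP; split => x.
    move=> /= H; case hx : (hi (x 0%N)); [right|left].
      by case=> [_|i] //=; exact: H.
    by case=> [_|i] //=; exact: H.
  by case=> H i lti; exact: (H i.+1).
apply/seteqP; split => // x [/(_ 0%N isT) /= + /(_ 0%N isT) /=].
by move=> ->.
Qed.

Lemma vertex_cylinder_rcons m s :
  m (vertex_cylinder s) =
  (m (vertex_cylinder (rcons s false)) + m (vertex_cylinder (rcons s true)))%E.
Proof.
have E b x : vertex_cylinder (rcons s b) x <->
    vertex_cylinder s x /\ hi (x (size s)) = b.
  rewrite /vertex_cylinder /= size_rcons; split.
    move=> H; split => [i lti|]; last by rewrite H // nth_rcons ltnn eqxx.
    by rewrite H ?nth_rcons ?lti // ltnW.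
  move=> [H e] i; rewrite ltnS nth_rcons leq_eqVlt => /orP[/eqP->|lti].
    by rewrite ltnn eqxx.
  by rewrite lti H.
rewrite -measureU; [|exact: measurable_vertex_cylinder..|].
  congr (m _); apply/seteqP; split => x.
    by move=> H; case hx : (hi (x (size s))); [right|left]; apply/E.
  by case=> /E[].
by apply/seteqP; split => // x [/E[_ +] /E[_]] => ->.
Qed.

End Measures.
End EdgeShift.

(** * Coin tossing from binary digits *)

Section BinaryDigits.
Variable R : realType.
Implicit Types t : R.

Definition digit (i : nat) t : bool := odd (Num.truncn (2 ^+ i.+1 * t)).

Fixpoint binary_value (s : nat -> bool) (n : nat) : nat :=
  if n is n'.+1 then ((binary_value s n').*2 + s n')%N else 0.

Lemma binary_value_lt s n : (binary_value s n < 2 ^ n)%N.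
Proof.
elim: n => [//|n IH] /=; rewrite expnS mul2n.
have : ((binary_value s n).+1 <= 2 ^ n)%N by [].
rewrite -leq_double doubleS => /(leq_trans _); apply.
by rewrite !ltnS; case: (s n); rewrite ?addn1 ?addn0.
Qed.

Lemma half_truncn t : 0 <= t -> (Num.truncn (2 * t))./2 = Num.truncn t.
Proof.
move=> t0; apply/esym/truncn_def.
have t20 : 0 <= 2 * t by rewrite mulr_ge0.
have := truncn_itv t20.
rewrite -[in X in X -> _](odd_double_half (Num.truncn (2 * t))).
set N := (_./2) => /andP[lo hi].
rewrite -mul2n -[ltRHS]natr1 natrD natrM in hi; rewrite -mul2n natrD natrM in lo.
rewrite -natr1; case: (odd _) lo hi => /= lo hi; apply/andP; split; lra.
Qed.

(** The integer part of 2^n t has the first n binary digits of t. *)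
Lemma digits_truncn s n t : 0 <= t < 1 ->
  (forall i, (i < n)%N -> digit i t = s i) <->
  Num.truncn (2 ^+ n * t) = binary_value s n.
Proof.
move=> /andP[t0 t1]; elim: n => [|n IH].
  by split => // _; apply: truncn_def; rewrite expr0 mul1r t0 t1.
have h : (Num.truncn (2 ^+ n.+1 * t))./2 = Num.truncn (2 ^+ n * t).
  by rewrite exprS -mulrA half_truncn // mulr_ge0 // exprn_ge0.
rewrite /=; split.
  move=> H; rewrite -(odd_double_half (Num.truncn (2 ^+ n.+1 * t))) h.
  rewrite -/(digit n t) H // addnC; congr (_.*2 + _)%N.
  by apply/IH => i lti; apply: H; exact: ltnW.
move=> e i; rewrite ltnS leq_eqVlt => /orP[/eqP->|].
  by rewrite /digit e oddD odd_double oddb.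
apply/IH: i; rewrite -h e halfD odd_double /= doubleK add0n.
by case: (s n); rewrite /= addn0.
Qed.

(** The interval is half-open so that the points with given first n digits form
    exactly one dyadic interval. *)
Definition unit_lebesgue : set (measurableTypeR R) -> \bar R :=
  mrestr (@lebesgue_measure R) (measurable_itv `[0%R, 1%R[).

Let restricted : {measure set (measurableTypeR R) -> \bar R} :=
  mrestr (@lebesgue_measure R) (measurable_itv `[0%R, 1%R[).

HB.instance Definition _ := isMeasure.Build _ (measurableTypeR R) R unit_lebesgue
  (measure0 restricted) (measure_ge0 restricted)
  (@measure_semi_sigma_additive _ _ _ restricted).

Let unit_lebesgueT : unit_lebesgue setT = 1%E.
Proof.
by rewrite /unit_lebesgue /mrestr setTI lebesgue_measure_itv /= lte01 oppr0 adde0.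
Qed.

HB.instance Definition _ := @Measure_isProbability.Build _ _ R
  unit_lebesgue unit_lebesgueT.

Lemma unit_lebesgue_digits s n :
  unit_lebesgue [set t | forall i, (i < n)%N -> digit i t = s i] = ((2^-1) ^+ n)%:E.
Proof.
pose N := binary_value s n; pose d : R := 2 ^+ n.
have d0 : 0 < d by apply: exprn_gt0.
have Nd : N.+1%:R <= d by rewrite /d -natrX ler_nat binary_value_lt.
rewrite /unit_lebesgue /mrestr (_ : _ `&` _ = [set` `[N%:R / d, N.+1%:R / d[%R]).
  rewrite lebesgue_measure_itv /= lte_fin ltr_pM2r ?invr_gt0 // ltr_nat ltnSn.
  rewrite -EFinD; congr EFin; rewrite -mulrBl -natr1 addrC addKr mul1r.
  by rewrite exprVn.
apply/seteqP; split => t /=.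
  rewrite !in_itv /= => -[H /andP[t0 t1]].
  have t01 : 0 <= t < 1 by rewrite t0.
  move/(digits_truncn s n t01): H => e.
  have dt0 : 0 <= d * t by rewrite mulr_ge0 // ltW.
  have := truncn_itv dt0; rewrite /d e -/N => /andP[h1 h2].
  by rewrite ler_pdivrMr // ltr_pdivlMr // mulrC h1 h2.
rewrite !in_itv /= ler_pdivrMr // ltr_pdivlMr // => /andP[h1 h2].
have t0 : 0 <= t.
  by rewrite -(pmulr_lge0 _ d0); apply: le_trans h1.
have t1 : t < 1.
  by rewrite -(ltr_pM2r d0) mul1r; apply: lt_le_trans h2 _.
split; last by rewrite t0.
apply/(digits_truncn s n); first by rewrite t0.
by apply: truncn_def; rewrite mulrC h1 h2.
Qed.

(** The digit i of t is 1 when the integer part of 2^(i+1) t is odd, that is on a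
    countable union of intervals. *)
Lemma measurable_digit i (b : bool) : measurable [set t | digit i t = b].
Proof.
have mtrue : measurable [set t | digit i t = true].
  rewrite (_ : [set t | _] = \bigcup_(N in [set N | odd N])
      [set` `[N%:R / 2 ^+ i.+1, N.+1%:R / 2 ^+ i.+1[%R]).
    by apply: bigcup_measurable => N _; exact: measurable_itv.
  have d0 : 0 < 2 ^+ i.+1 :> R by apply: exprn_gt0.
  apply/seteqP; split => t /=.
    move=> o; exists (Num.truncn (2 ^+ i.+1 * t)) => //=.
    rewrite in_itv /= ler_pdivrMr // ltr_pdivlMr // mulrC.
    apply: truncn_itv; apply/ltW; rewrite (lt_le_trans ltr01) // -truncn_gt0.
    rewrite lt0n; apply: contraL o => /eqP e.
    by rewrite /digit mulrC e.
  move=> [N oN /=]; rewrite in_itv /= ler_pdivrMr // ltr_pdivlMr // mulrC => h.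
  by rewrite /digit (truncn_def h).
case: b => //.
rewrite (_ : [set t | _] = ~` [set t | digit i t = true]); first exact: measurableC.
by apply/seteqP; split => t /=; case: (digit i t).
Qed.

Definition digit_path (t : measurableTypeR R) : fullshift 3 := edge_path (digit^~ t).

Lemma measurable_digit_path : measurable_fun setT digit_path.
Proof.
apply: (measurability _ (borel_cylinders 3)).
move=> _ [_ [->|[n [w ->]]] <-]; first by rewrite preimage_set0 setI0.
rewrite setTI (_ : _ @^-1` _ = \bigcap_i [set t | forall ltin : (i < n)%N,
    digit i t = hi (tnth w (Ordinal ltin)) /\
    digit i.+1 t = lo (tnth w (Ordinal ltin))]).
  apply: bigcapT_measurable => i; case: (pselect (i < n)%N) => [lti|nlti].
    rewrite (_ : [set t | _] =
      [set t | digit i t = hi (tnth w (Ordinal lti))] `&`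
      [set t | digit i.+1 t = lo (tnth w (Ordinal lti))]).
      by apply: measurableI; exact: measurable_digit.
    apply/seteqP; split => t /=; first exact.
    by move=> H lti'; rewrite (bool_irrelevance lti' lti).
  by rewrite (_ : [set t | _] = setT) //; apply/seteqP; split => // t _ /= lti.
apply/seteqP; split => t /=.
  by move=> [_ <-] i _ lti; rewrite tnth_mktuple /= hi_edge lo_edge.
move=> H; split => //; apply: eq_from_tnth => -[i lti]; rewrite tnth_mktuple /=.
have [e1 e2] := H i I lti.
by rewrite /digit_path /edge_path e1 e2 edge_hi_lo.
Qed.

HB.instance Definition _ := @isMeasurableFun.Build _ _
  (measurableTypeR R) (fullshift 3) digit_path measurable_digit_path.

Definition coin_measure : probability (fullshift 3) R :=
  distribution unit_lebesgue
    (digit_path : {mfun measurableTypeR R >-> fullshift 3}).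

Lemma coin_measure_support : coin_measure (SFT edge_matrix) = 1%E.
Proof.
rewrite -unit_lebesgueT; congr (unit_lebesgue _).
by apply/seteqP; split => // t _; exact: edge_pathX.
Qed.

Lemma coin_measure_vertex_cylinder s :
  coin_measure (vertex_cylinder s) = ((2^-1) ^+ size s)%:E.
Proof.
rewrite -(unit_lebesgue_digits (nth false s)).
congr (unit_lebesgue _).
by apply/seteqP; split => t H i lti; have := H i lti; rewrite /= /digit_path hi_edge.
Qed.

End BinaryDigits.

(** * Gibbs property, uniqueness and the difference factor *)

Lemma measurable_shift k : measurable_fun [set: fullshift k] (@Defs.shift k).
Proof.
apply: (@measurability _ _ _ _ _ _ (@open (fullshift k))) => //.
move=> _ [B oB <-]; rewrite setTI; apply: sub_sigma_algebra.
apply: open_comp => // x _; move: x.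
apply: (@continuous_coord (fullshift k) (discrete_topology 'I_k.+1)) => i x.
exact: (@proj_continuous nat (fun=> discrete_topology 'I_k.+1) i.+1 x).
Qed.

HB.instance Definition _ (k : nat) := @isMeasurableFun.Build _ _
  (fullshift k) (fullshift k) (@Defs.shift k) (@measurable_shift k).

Section CoinMeasure.
Variable R : realType.
Local Notation X := (SFT edge_matrix : set (fullshift 3)).
Local Notation coin := (coin_measure R).

Lemma birkhoff0 k n (x : fullshift k) : birkhoff (fun=> 0 : R) n x = 0.
Proof. by rewrite /birkhoff big1. Qed.

Lemma expR_entropy n : expR (- n%:R * ln 2) = (2^-1 : R) ^+ n.
Proof. by rewrite mulNr expRN expRM_natl lnK ?posrE // exprVn. Qed.

(** A word s preceded by a free letter has the mass of two words of length one more. *)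
Lemma coin_invariant B : measurable B -> coin (@Defs.shift 3 @^-1` B) = coin B.
Proof.
pose coin' : probability (fullshift 3) R :=
  distribution coin (@Defs.shift 3 : {mfun fullshift 3 >-> fullshift 3}).
apply: (@eq_measure_edge_shift _ coin' coin).
- apply/eqP; rewrite eq_le probability_le1 /=; last exact: measurable_SFT.
  rewrite -(coin_measure_support R); apply: le_measure; rewrite ?inE.
  + exact: measurable_SFT.
  + rewrite -[_ @^-1` _]setTI; apply: measurable_shift => //.
    exact: measurable_SFT.
  + by move=> x Xx i; exact: Xx.
- exact: coin_measure_support.
move=> s; rewrite [LHS]vertex_cylinder_shift !coin_measure_vertex_cylinder /=.
by rewrite -EFinD exprS; congr EFin; field.
Qed.

Lemma coin_cylinder n x : X x -> (0 < n)%N ->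
  coin (cylinder X (block n x)) = ((2^-1) ^+ n.+1)%:E.
Proof.
case: n => // n Xx _; rewrite cylinder_edge_shift // probability_setI_full //.
- by rewrite coin_measure_vertex_cylinder size_mkseq.
- exact: coin_measure_support.
- exact: measurable_vertex_cylinder.
Qed.

Lemma gibbs_coin : gibbs X (fun=> 0) coin.
Proof.
split; first by split; [exact: coin_measure_support|exact: coin_invariant].
exists (ln 2), 2; split => // x n Xx n0.
rewrite coin_cylinder //= birkhoff0 addr0 expR_entropy exprSr.
have h0 : (2^-1 : R) ^+ n != 0 by rewrite expf_neq0 // invr_neq0.
by rewrite mulrAC divff // mul1r lexx /=; lra.
Qed.

(** All words of length n + 1 have mass e^(-nP) up to a factor C, and their masses
    sum to 1, so that the ratio r to the coin measure is at most C^2.  Invariance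
    and additivity make r balanced on the left and on the right, hence r = 1. *)
Lemma gibbs_edge_shift_unique (nu : probability (fullshift 3) R) :
  gibbs X (fun=> 0) nu -> forall B, measurable B -> nu B = coin B.
Proof.
move=> [[nuX nuI] [P [C [C0 g]]]].
have mV := measurable_vertex_cylinder.
pose r (s : seq bool) : R := 2 ^+ size s * fine (nu (vertex_cylinder s)).
have fin s : nu (vertex_cylinder s) \is a fin_num by apply: fin_num_measure.
have r_nil : r [::] = 1.
  rewrite /r expr0 mul1r (_ : vertex_cylinder _ = setT) ?probability_setT //.
  by apply/seteqP; split.
have r_rcons s : r s = (r (rcons s false) + r (rcons s true)) / 2.
  rewrite /r !size_rcons (vertex_cylinder_rcons nu s) fineD // exprS.
  by field.
have r_cons s : r s = (r (false :: s) + r (true :: s)) / 2.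
  by rewrite /r -(nuI _ (mV s)) vertex_cylinder_shift fineD //= exprS; field.
pose b n := expR (- n%:R * P).
have bound s : (1 < size s)%N ->
    C^-1 * b (size s).-1 <= fine (nu (vertex_cylinder s)) <= C * b (size s).-1.
  move=> s2; have n0 : (0 < (size s).-1)%N by case: s s2 => [|? []].
  have Xs := edge_pathX (nth false s).
  have := g _ _ Xs n0; rewrite cylinder_edge_shift // probability_setI_full //.
  rewrite (_ : vertex_cylinder _ = vertex_cylinder s); last first.
    congr vertex_cylinder; apply: (@eq_from_nth _ false).
      by rewrite size_mkseq; case: (size s) n0 => [//|[]].
    rewrite size_mkseq => i; case: (size s) n0 => [//|[//|n]] _ lti.
    by rewrite nth_mkseq // hi_edge.
  rewrite birkhoff0 addr0 -/(b _) ler_pdivlMr ?expR_gt0 // ler_pdivrMr ?expR_gt0 //.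
have r_bound s : (1 < size s)%N -> `|r s| <= C ^+ 2.
  move=> s2; have /andP[_ hi_s] := bound s s2.
  rewrite ger0_norm; last by rewrite mulr_ge0 ?exprn_ge0 // fine_ge0.
  (* The lower Gibbs bound, averaged over all words of this length. *)
  have tot : 2 ^+ size s * (C^-1 * b (size s).-1) <= 1.
    rewrite -[leRHS]r_nil -[leRHS](bavg_prefix r_rcons (size s) [::]).
    rewrite -[leLHS](bavg_cst (size s)); apply: le_bavg => v sv.
    rewrite /r /= sv ler_pM2l ?exprn_gt0 //.
    by have := bound v; rewrite sv => /(_ s2)/andP[].
  rewrite /r; apply: (@le_trans _ _ (2 ^+ size s * (C * b (size s).-1))).
    by rewrite ler_pM2l // exprn_gt0.
  rewrite [leLHS](_ : _ = C ^+ 2 * (2 ^+ size s * (C^-1 * b (size s).-1))).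
    by rewrite ler_piMr // exprn_ge0 // ltW.
  by field; rewrite gt_eqF.
apply: eq_measure_edge_shift => //; first exact: coin_measure_support.
move=> s; rewrite coin_measure_vertex_cylinder -[LHS]fineK //; congr EFin.
have := bounded_balanced_eq1 r_nil r_cons r_rcons r_bound s.
rewrite /r exprVn => e; apply: (mulfI (x := 2 ^+ size s)); first by rewrite expf_neq0.
by rewrite e divff // expf_neq0.
Qed.

Definition edge_difference (a : 'I_4) : 'I_2 := inord (hi a (+) lo a).

Lemma odd_edge_difference a : odd (edge_difference a) = hi a (+) lo a.
Proof. by rewrite /edge_difference inordK; case: (_ (+) _). Qed.

Lemma edge_differenceP a (c : 'I_2) : edge_difference a = c <-> hi a (+) lo a = odd c.
Proof.
rewrite -odd_edge_difference; split=> [->//|].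
by case: (edge_difference a) c => [[|[|?]] ?] [[|[|?]] ?] //= _; exact: val_inj.
Qed.

(** The sequence of vertices that starts at b and has the differences y. *)
Fixpoint vertex_lift (b : bool) (y : fullshift 1) (i : nat) : bool :=
  if i is i'.+1 then vertex_lift b y i' (+) odd (y i') else b.

(** A path is determined by its first vertex and by its successive differences. *)
Lemma vertex_lift_fiber n x y : X x ->
  (forall i, (i < n)%N -> edge_difference (x i) = y i) <->
  (forall i, (i < n.+1)%N -> hi (x i) = vertex_lift (hi (x 0%N)) y i).
Proof.
move=> /edge_shiftP ex; split => H.
  elim=> [//|i IH] lti; rewrite /= -IH; last exact: ltnW.
  have /edge_differenceP := H i lti; rewrite ex => <-.
  by rewrite addbA addbb.
move=> i lti; apply/edge_differenceP; rewrite ex (H i) ?(H i.+1) //=; last exact: ltnW.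
by rewrite addbA addbb.
Qed.

Lemma edge_factor_onto : letterwise edge_difference @` X = setT.
Proof.
apply/seteqP; split => // y _.
exists (edge_path (vertex_lift false y)); first exact: edge_pathX.
apply/funext => i; apply/edge_differenceP.
by rewrite hi_edge lo_edge /= addbA addbb.
Qed.

(** The two lifts of y start at different vertices and have the mass of a word of
    length n + 1 each. *)
Lemma coin_fiber n y :
  coin (X `&` [set x | map_tuple edge_difference (block n x) == block n y]) =
  ((2^-1) ^+ n)%:E.
Proof.
have mV := measurable_vertex_cylinder.
have E : X `&` [set x | map_tuple edge_difference (block n x) == block n y] =
    X `&` (vertex_cylinder (mkseq (vertex_lift false y) n.+1) `|`
           vertex_cylinder (mkseq (vertex_lift true y) n.+1)).
  apply/seteqP; split => x [Xx H]; split => //.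
    move: H => /= /eqP; rewrite map_block => /eq_block /(vertex_lift_fiber _ _ Xx) H.
    by case h0: (hi (x 0%N)) H => H; [right|left]; apply/vertex_cylinder_mkseq.
  apply/eqP; rewrite map_block; apply/eq_block/(vertex_lift_fiber _ _ Xx).
  case: H => /vertex_cylinder_mkseq H; by rewrite (H 0%N isT).
rewrite E probability_setI_full; [|exact: coin_measure_support|exact: measurableU].
transitivity (coin (vertex_cylinder (mkseq (vertex_lift false y) n.+1)) +
    coin (vertex_cylinder (mkseq (vertex_lift true y) n.+1)))%E.
  apply: measureU => //; apply/seteqP; split => // x.
  move=> [/vertex_cylinder_mkseq/(_ 0%N isT) /= +].
  by move=> + /vertex_cylinder_mkseq/(_ 0%N isT) /= => ->.
rewrite !coin_measure_vertex_cylinder !size_mkseq -EFinD exprS; congr EFin.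
by field.
Qed.

Lemma coin_fiber_mass n y : fiber_mass edge_difference X coin n y = (2^-1) ^+ n.
Proof.
have := coin_fiber n y.
rewrite (measure_block_sum coin
  (fun w => map_tuple edge_difference w == block n y) (measurable_SFT _)).
rewrite /fiber_mass => e; apply: EFin_inj; rewrite /mass EFin_sum_fine; first exact: e.
by move=> w _; apply: fin_num_measure; apply: measurable_cylinder; exact: measurable_SFT.
Qed.

Lemma gibbs_image_coin :
  gibbs setT (fun=> 0) (image_measure edge_difference coin).
Proof.
split.
  split; first exact: probability_setT.
  move=> B mB; apply: (coin_invariant (B := letterwise edge_difference @^-1` B)).
  by rewrite -[_ @^-1` _]setTI; apply: measurable_letterwise.
exists (ln 2), 1; split => // y n _ _; rewrite birkhoff0 addr0 expR_entropy.
have -> : image_measure edge_difference coin (cylinder setT (block n y)) =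
    ((2^-1) ^+ n)%:E.
  rewrite -(coin_fiber n y) probability_setI_full; first last.
  - exact: (measurable_block [set w | map_tuple edge_difference w == block n y]).
  - exact: coin_measure_support.
  congr (coin _); apply/seteqP; split => x /=.
    by move=> [_ e]; rewrite map_block e.
  by move=> /eqP; rewrite map_block.
by rewrite /= divff ?invr1 ?lexx // expf_neq0 // invr_neq0.
Qed.

(** The paths over 0, ..., 0 are the two constant ones; a path that starts on one of
    them never reaches the other. *)
Lemma edge_factor_not_mixing :
  ~ fiberwise_sub_positive_mixing edge_difference X setT.
Proof.
move=> [q mixing]; pose y0 : fullshift 1 := fun=> ord0.
have y0q : blocks [set: fullshift 1] (block q.+1 y0) by exists y0.
have {y0q}H := mixing _ y0q.
have dX b : X (edge_path (fun=> b)) by exact: edge_pathX.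
have dp b : map_tuple edge_difference (block q.+1 (edge_path (fun=> b))) =
    block q.+1 y0.
  rewrite map_block; apply/eq_block => i _; apply/edge_differenceP.
  by rewrite hi_edge lo_edge addbb.
have [||||a [[x Xx <-]]] := H (block q.+1 (edge_path (fun=> false)))
  (block q.+1 (edge_path (fun=> true))) => //.
- by exists (edge_path (fun=> false)).
- by exists (edge_path (fun=> true)).
rewrite !tnth_mktuple map_block => x0 xq /eq_block xp.
suff hx i : (i <= q)%N -> hi (x i) = false.
  by have := hx q (leqnn q); rewrite (_ : x q = edge true true) ?hi_edge.
have /edge_shiftP ex := Xx.
elim: i => [|i IH] lti; first by rewrite [x 0%N]x0 hi_edge.
have /edge_differenceP := xp i (ltnW lti).
by rewrite ex IH ?(ltnW lti).
Qed.

End CoinMeasure.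

Theorem proposition4p1 (R : realType) :
  (forall (k l : nat) (X : set (fullshift k)) (Y : set (fullshift l))
      (p : 'I_k.+1 -> 'I_l.+1) (f : fullshift k -> R)
      (mu : probability (fullshift k) R),
    mixing_SFT X -> subshift Y -> one_block_factor p X Y ->
    {within X, continuous f} -> unique_gibbs X f mu ->
    fiberwise_sub_positive_mixing p X Y ->
    almost_additive Y (relative_partition p X f))
  /\
  (exists (k l : nat) (X : set (fullshift k)) (Y : set (fullshift l))
      (p : 'I_k.+1 -> 'I_l.+1) (f : fullshift k -> R)
      (mu : probability (fullshift k) R),
    [/\ mixing_SFT X, subshift Y, one_block_factor p X Y &
        ~ fiberwise_sub_positive_mixing p X Y] /\
    [/\ {within X, continuous f}, unique_gibbs X f mu,
        almost_additive Y (relative_partition p X f) &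
        exists g : fullshift l -> R,
          {within Y, continuous g} /\ gibbs Y g (image_measure p mu)]).
Proof.
split.
  move=> k l X Y p f mu [A [_ _ ->]] _ factor _ [gmu _] mixing.
  exact: mixing_almost_additive factor gmu mixing.
exists 3%N, 1%N, (SFT edge_matrix), setT, edge_difference, (fun=> 0), (coin_measure R).
split; split.
- exact: mixing_edge_shift.
- by split; [exact: closedT|].
- split => //; last exact: edge_factor_onto.
  by apply: continuous_subspaceT; exact: letterwise_continuous.
- exact: edge_factor_not_mixing.
- by apply: continuous_subspaceT => x; exact: cst_continuous.
- by split; [exact: gibbs_coin|exact: gibbs_edge_shift_unique].
- apply: (almost_additive_fiber_mass (gibbs_coin R)); exists 1; split => //.
  by move=> y n n' _; rewrite !coin_fiber_mass exprD !mul1r.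
- exists (fun=> 0); split; last exact: gibbs_image_coin.
  by apply: continuous_subspaceT => x; exact: cst_continuous.
Qed.
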